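(* Let $\kappa$ be a finite field, let $X\subset\mathbb{A}^N_\kappa$ be a subscheme of codimension $\theta$, and let $d$ be the sum of the degrees of its irreducible components. Let $B_1,\dots,B_N$ be subsets of $\kappa$ with $1\le\#B_1\le\#B_2\le\dots\le\#B_N<\infty$, and let $B:=\prod_{i=1}^NB_i$, regarded as a subset of $\mathbb{A}^N(\kappa)$. Then \[\#\Bigl(X(\kappa)\cap\prod_{i=1}^NB_i\Bigr)\le d\prod_{i=\theta+1}^N\#B_i=d(\#B)\prod_{i=1}^\theta(\#B_i)^{-1}.\]
   Context: The degree of a (locally closed) subscheme of $\mathbb{A}^N_\kappa$ is the degree of its closure in $\mathbb{P}^N_\kappa$. *)

(* Defs.v *)
From HB Require Import structures.
From mathcomp Require Import all_boot all_order all_algebra.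
From mathcomp Require Import ring_quotient.
From mathcomp Require Import boolp classical_sets functions cardinality fsbigop.
From mathcomp Require Import mpoly.

Set Implicit Arguments.
Unset Strict Implicit.
Unset Printing Implicit Defensive.

Import Order.TTheory GRing.Theory Num.Theory.

Local Open Scope classical_set_scope.
Local Open Scope ring_scope.

(** * Irreducible subsets, for a topology given by its closed sets *)

Definition irreducible_set (T : Type) (closed : set (set T)) (Z : set T) : Prop :=
  Z !=set0 /\
  forall C1 C2 : set T, closed C1 -> closed C2 ->
    Z `<=` C1 `|` C2 -> Z `<=` C1 \/ Z `<=` C2.

Definition irreducible_components (T : Type) (closed : set (set T))
    (X : set T) : set (set T) :=
  [set Z | [/\ Z `<=` X, irreducible_set closed Z &
     forall Z', Z' `<=` X -> irreducible_set closed Z' -> Z `<=` Z' -> Z' = Z]].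

(** * Affine space as the set of prime ideals of [k[x_0, ..., x_(N-1)]] *)

Definition affine_space (k : fieldType) (N : nat) : Type :=
  prime_idealr {mpoly k[N]}.

Definition affine_zeros (k : fieldType) (N : nat) (S : set {mpoly k[N]}) :
    set (affine_space k N) :=
  [set p | forall f, S f -> f \in (p : pred _)].

Definition affine_closed (k : fieldType) (N : nat) :
    set (set (affine_space k N)) :=
  [set C | exists S : set {mpoly k[N]}, C = affine_zeros S].

(** * Subschemes of affine space *)

(* [idealr] of [ring_quotient] only covers proper ideals; the unit ideal is
   allowed here. *)
Definition is_ideal (R : comNzRingType) (I : set R) : Prop :=
  [/\ I 0, forall f g, I f -> I g -> I (f + g) & forall a f, I f -> I (a * f)].

(* As affine space is Noetherian, every locally closed subscheme is the open
   subscheme [V(sub_ideal) \ V(sub_away)] of a closed subscheme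
   [V(sub_ideal)]. *)
Record subscheme (k : fieldType) (N : nat) := Subscheme {
  sub_ideal : set {mpoly k[N]};
  sub_away : set {mpoly k[N]};
  sub_ideal_is_ideal : is_ideal sub_ideal;
  sub_away_is_ideal : is_ideal sub_away
}.

Definition support (k : fieldType) (N : nat) (X : subscheme k N) :
    set (affine_space k N) :=
  affine_zeros (sub_ideal X) `\` affine_zeros (sub_away X).

(* [X(k)]: the [x] in [k^N] whose evaluation morphism factors through [X]. *)
Definition rational_points (k : fieldType) (N : nat) (X : subscheme k N) :
    set {ffun 'I_N -> k} :=
  [set x | (forall f, sub_ideal X f -> f.@[x] = 0) /\
           (exists2 g, sub_away X g & g.@[x] != 0)].

Definition components (k : fieldType) (N : nat) (X : subscheme k N) :
    set (set (affine_space k N)) :=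
  irreducible_components (@affine_closed k N) (support X).

(** * Codimension *)

Definition has_chain_above (k : fieldType) (N : nat)
    (Y : set (affine_space k N)) (n : nat) : Prop :=
  exists Zs : nat -> set (affine_space k N),
    [/\ Zs 0%N = Y,
        forall i, (i <= n)%N ->
          affine_closed (Zs i) /\ irreducible_set (@affine_closed k N) (Zs i) &
        forall i, (i < n)%N -> Zs i `<` Zs i.+1].

(* An irreducible locally closed [Z] has the codimension of its closure. *)
Definition irreducible_codim_is (k : fieldType) (N : nat)
    (Z : set (affine_space k N)) (n : nat) : Prop :=
  let Y := smallest (@affine_closed k N) Z in
  has_chain_above Y n /\ forall m, has_chain_above Y m -> (m <= n)%N.

(* The minimum over the irreducible components; it forces [X] to be nonempty,
   since the empty subscheme has no finite codimension. *)
Definition codim_is (k : fieldType) (N : nat) (X : subscheme k N)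
    (theta : nat) : Prop :=
  (exists2 Z, components X Z & irreducible_codim_is Z theta) /\
  (forall Z n, components X Z -> irreducible_codim_is Z n -> (theta <= n)%N).

(** * Projective space as the set of relevant homogeneous prime ideals *)

Record proj_space (k : fieldType) (N : nat) := ProjPoint {
  proj_ideal : prime_idealr {mpoly k[N.+1]};
  proj_homogeneous : forall F m, F \in (proj_ideal : pred _) ->
    pihomog mdeg m F \in (proj_ideal : pred _);
  proj_relevant : exists i : 'I_N.+1, 'X_i \notin (proj_ideal : pred _)
}.

Definition proj_zeros (k : fieldType) (N : nat) (S : set {mpoly k[N.+1]}) :
    set (proj_space k N) :=
  [set q | forall F, S F -> F \in (proj_ideal q : pred _)].

Definition proj_closed (k : fieldType) (N : nat) : set (set (proj_space k N)) :=
  [set C | exists S : set {mpoly k[N.+1]}, C = proj_zeros S].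

(* [F(X_0, ..., X_N)] is sent to [F(1, x_0, ..., x_(N-1))]. *)
Definition dehomogenize (k : fieldType) (N : nat) (F : {mpoly k[N.+1]}) :
    {mpoly k[N]} :=
  F \mPo [tuple oapp (fun j => 'X_j : {mpoly k[N]}) 1 (unlift ord0 i) | i < N.+1].

(* [q] is the image of [p] under the identification of affine space with the
   standard open [X_0 != 0] of projective space. *)
Definition chart (k : fieldType) (N : nat) (p : affine_space k N)
    (q : proj_space k N) : Prop :=
  forall m (F : {mpoly k[N.+1]}), F \is m.-homog ->
    (F \in (proj_ideal q : pred _)) = (dehomogenize F \in (p : pred _)).

Definition proj_closure (k : fieldType) (N : nat) (Z : set (affine_space k N)) :
    set (proj_space k N) :=
  smallest (@proj_closed k N) [set q | exists2 p, Z p & chart p q].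

(** * Degree *)

(* The degree-[m] part of the homogeneous ideal of [W] (with its reduced
   structure). The conditions on [U] hold for exactly one subspace. *)
Definition vanishing_forms (k : fieldType) (N : nat) (W : set (proj_space k N))
    (m : nat) : {vspace (dhomog N.+1 k m)} :=
  xget 0%VS [set U : {vspace (dhomog N.+1 k m)} |
    forall F : dhomog N.+1 k m,
      F \in U <-> forall q, W q -> (F : {mpoly k[N.+1]}) \in (proj_ideal q : pred _)].

Definition hilbert_function (k : fieldType) (N : nat) (W : set (proj_space k N))
    (m : nat) : nat :=
  (\dim (fullv : {vspace (dhomog N.+1 k m)}) - \dim (vanishing_forms W m))%N.

Definition hilbert_polynomial (k : fieldType) (N : nat)
    (W : set (proj_space k N)) : {poly rat} :=
  xget 0 [set P : {poly rat} | exists m0 : nat, forall m : nat,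
    (m0 <= m)%N -> P.[m%:R] = (hilbert_function W m)%:R].

Definition proj_degree (k : fieldType) (N : nat) (W : set (proj_space k N)) : rat :=
  let P := hilbert_polynomial W in ((size P).-1)`!%:R * lead_coef P.

Definition degree (k : fieldType) (N : nat) (Z : set (affine_space k N)) : rat :=
  proj_degree (proj_closure Z).

Definition degree_sum (k : fieldType) (N : nat) (X : subscheme k N) : rat :=
  \sum_(Z \in components X) degree Z.

(** * Boxes *)

Definition box (k : finFieldType) (N : nat) (B : 'I_N -> {set k}) :
    {set {ffun 'I_N -> k}} :=
  [set x : {ffun 'I_N -> k} | [forall i, x i \in B i]]%SET.

(* Main.v *)
(* Everything is read off the dimension [hilb P b] of the polynomials of degree < [b]
   modulo a prime [P], which is eventually polynomial with leading term
   (degree / n!) [b^n].  A chain of primes below [P] makes this degree drop strictly,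
   so [n] is at most [N] minus the codimension.

   Put [w_i = #B_i] and [f_i = \prod_(b in B_i) (x_i - b)].  For a point [s] of the box
   on the variety of [P], suppose that no element of [P] has an initial monomial at [s]
   (for the weights [w], lowest first) in the variables of a set [T_s] of size [n].  Then the
   products of a Lagrange indicator of [s] and of [f^a], [a] supported in [T_s], [s] varying,
   are linearly independent modulo [P]; they have degree about [\sum_i a_i w_i], and counting
   them gives #S / (n! \prod_(i in T_s) w_i) <= degree / n!.

   The set [T_s] exists because the local ring at [s] has full dimension [n].  As the field is
   finite this follows without Krull's theorem: for [Q] a power of #k, the ring [k[x]/P] has
   rank at least [Q^n] over its [Q]-th powers, and by Nakayama it is generated at the rational
   point [s] by as many elements as there are monomials outside the initial ideal,
   modulo the [Q]-th powers of the coordinates.  A set of monomials closed under divisors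
   with so many elements for every [Q] contains all monomials in some [n] variables. *)
From HB Require Import structures.
Require Import Defs.
From mathcomp Require Import all_boot all_order all_algebra.
From mathcomp Require Import all_fingroup all_solvable ring_quotient.
From mathcomp Require Import boolp classical_sets cardinality fsbigop.
From mathcomp Require Import mpoly zify lra.

Set Implicit Arguments.
Unset Strict Implicit.
Unset Printing Implicit Defensive.

Import Order.TTheory GRing.Theory Num.Theory.

Local Open Scope ring_scope.

(** * Rational polynomials at large integers *)

Definition eventually (A : nat -> Prop) : Prop :=
  exists m0, forall m, (m0 <= m)%N -> A m.

Lemma eventually_and (A B : nat -> Prop) :
  eventually A -> eventually B -> eventually (fun m => A m /\ B m).
Proof.
move=> [a ha] [b hb]; exists (maxn a b) => m; rewrite geq_max => /andP[am bm].
by split; [exact: ha | exact: hb].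
Qed.

Lemma eventually_imp (A B : nat -> Prop) :
  (forall m, A m -> B m) -> eventually A -> eventually B.
Proof. by move=> AB [a ha]; exists a => m /ha /AB. Qed.

Lemma eventually_ex (A : nat -> Prop) : eventually A -> exists m, A m.
Proof. by move=> [a ha]; exists a; exact: ha. Qed.

Lemma eventually_comp (A : nat -> Prop) (f : nat -> nat) :
  (forall m, (m <= f m)%N) -> eventually A -> eventually (fun m => A (f m)).
Proof.
by move=> fge [a ha]; exists a => m am; apply: ha; exact: leq_trans am (fge m).
Qed.

(** A lower bound [e], stronger than positivity, carries the induction on [P * 'X + c]: once [m]
    exceeds [1 - c / e], the term [e * m] outweighs [c] and the same [e] works again. *)
Lemma lead_coef_gt0_eventually (P : {poly rat}) : 0 < lead_coef P ->
  exists2 e : rat, 0 < e & eventually (fun m => e <= P.[m%:R]).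
Proof.
elim/poly_ind: P => [|P c IH]; first by rewrite lead_coef0.
have [->|P0] := eqVneq P 0.
  rewrite mul0r add0r lead_coefC => c0; exists c => //.
  by exists 0%N => m _; rewrite hornerC.
rewrite lead_coefDl; last first.
  by rewrite size_mulX // size_polyC ltnS; case: (c != 0) => //=; rewrite size_poly_gt0.
rewrite lead_coefMX => /IH [e e0 [m0 hm]]; exists e => //.
have [m1 hm1] : exists m1 : nat, 1 - c / e < m1%:R.
  by exists (Num.truncn (1 - c / e)).+1; rewrite truncnS_gt.
exists (maxn m0 m1) => m; rewrite geq_max => /andP[m0m m1m].
rewrite hornerMXaddC.
have m1R : (m1%:R <= m%:R :> rat) by rewrite ler_nat.
have h1 : 1 - c / e <= m%:R by apply/ltW/(lt_le_trans hm1).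
have h2 : e * (1 - c / e) <= e * m%:R by rewrite ler_pM2l.
have h3 : e * m%:R <= P.[m%:R] * m%:R by apply: ler_wpM2r; rewrite ?ler0n ?hm.
have h4 : e * (1 - c / e) = e - c by rewrite mulrBr mulr1 mulrCA divff ?gt_eqF // mulr1.
lra.
Qed.

Lemma lead_coef_ge0_eventually (P : {poly rat}) :
  eventually (fun m => 0 <= P.[m%:R]) -> 0 <= lead_coef P.
Proof.
move=> hP; rewrite leNgt; apply/negP => lP.
have : 0 < lead_coef (- P) by rewrite lead_coefN oppr_gt0.
case/lead_coef_gt0_eventually => e e0 he.
have [m []] := eventually_ex (eventually_and hP he).
by rewrite hornerN => h1 h2; lra.
Qed.

Lemma size_le_eventually (P Q : {poly rat}) : 0 < lead_coef P ->
  eventually (fun m => P.[m%:R] <= Q.[m%:R]) -> (size P <= size Q)%N.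
Proof.
move=> lP h; rewrite leqNgt; apply/negP => sz.
have : 0 <= lead_coef (Q - P).
  apply: lead_coef_ge0_eventually; apply: eventually_imp h => m.
  by rewrite hornerD hornerN subr_ge0.
by rewrite lead_coefDr ?size_polyN // lead_coefN; lra.
Qed.

(** Otherwise [Q - P] would keep the common size and have a negative leading coefficient, hence
    negative values at large integers. *)
Lemma lead_coef_le_eventually (P Q : {poly rat}) : size P = size Q ->
  eventually (fun m => P.[m%:R] <= Q.[m%:R]) -> lead_coef P <= lead_coef Q.
Proof.
move=> sz h; rewrite leNgt; apply/negP => lt.
have : 0 <= lead_coef (Q - P).
  apply: lead_coef_ge0_eventually; apply: eventually_imp h => m.
  by rewrite hornerD hornerN subr_ge0.
have top : (Q - P)`_(size P).-1 = lead_coef Q - lead_coef P.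
  by rewrite coefB !lead_coefE sz.
have szQP : size (Q - P) = size P.
  apply/eqP; rewrite eqn_leq; apply/andP; split.
    by rewrite (leq_trans (size_polyD _ _)) // size_polyN -sz maxnn.
  have [->|P0] := eqVneq P 0; first by rewrite size_poly0.
  rewrite leqNgt; apply/negP => hs.
  have hs' : (size (Q - P)%R <= (size P).-1)%N by rewrite -ltnS prednK ?size_poly_gt0.
  by move: top; rewrite nth_default // => /esym/eqP; rewrite subr_eq0 lt_eqF.
by rewrite lead_coefE szQP top; lra.
Qed.

Lemma poly_eq_eventually (P Q : {poly rat}) :
  eventually (fun m => P.[m%:R] = Q.[m%:R]) -> P = Q.
Proof.
move=> [a ha]; apply/eqP; rewrite -subr_eq0; apply/negPn/negP => D0.
pose rs := [seq (m%:R : rat) | m <- iota a (size (P - Q))].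
have: (size rs < size (P - Q)%R)%N.
  apply: max_poly_roots D0 _ _.
    apply/allP => x /mapP[m]; rewrite mem_iota => /andP[am _] ->.
    by rewrite rootE hornerD hornerN ha // subrr.
  by rewrite map_inj_uniq ?iota_uniq // => x y /eqP; rewrite eqr_nat => /eqP.
by rewrite size_map size_iota ltnn.
Qed.

(** * Dickson's lemma and monomial counts *)

(** The subsequence follows tail minima: each search starts after the previous position and stops
    where [v] is least from there on. *)
Lemma monotone_subsequence (v : nat -> nat) :
  exists2 phi : nat -> nat, (forall i j, (i < j)%N -> (phi i < phi j)%N) &
    forall i j, (i <= j)%N -> (v (phi i) <= v (phi j))%N.
Proof.
have ex n : exists m, (n <= m)%N /\ forall l, (n <= l)%N -> (v m <= v l)%N.
  have exv : exists x, `[< exists2 m, (n <= m)%N & v m = x >].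
    by exists (v n); apply/asboolP; exists n.
  have [x /asboolP[m nm <-] xmin] := ex_minnP exv.
  by exists m; split=> // l nl; apply: xmin; apply/asboolP; exists l.
have [f hf] := choice ex.
pose fix phi k := if k is k'.+1 then f (phi k').+1 else f 0%N.
have phiS k : (phi k < phi k.+1)%N by have [] := hf (phi k).+1.
have phimono := homo_ltn ltn_trans phiS.
exists phi; first exact: phimono.
have vmin k l : (phi k <= l)%N -> (v (phi k) <= v l)%N.
  case: k => [|k] /= h.
    by have [_ ->] := hf 0%N.
  have [h1 ->] := hf (phi k).+1 => //.
  exact: leq_trans h.
move=> i j; rewrite leq_eqVlt => /predU1P[->//|ij].
by apply: vmin; apply/ltnW/phimono.
Qed.

(** Subsequences are refined one coordinate at a time, along a list of coordinates, until all are
    monotone; then any two indices do. *)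
Lemma dickson (n : nat) (u : nat -> 'X_{1..n}) :
  exists i j, (i < j)%N /\ (u i <= u j)%MM.
Proof.
have [phi [pmono hphi]] : exists phi : nat -> nat,
    (forall i j, (i < j)%N -> (phi i < phi j)%N) /\
    forall c, c \in enum 'I_n -> forall i j, (i <= j)%N -> (u (phi i) c <= u (phi j) c)%N.
  elim: (enum 'I_n) => [|c s [phi [pm IH]]]; first by exists id.
  have [psi qm hpsi] := monotone_subsequence (fun k => u (phi k) c).
  exists (phi \o psi); split => [i j ij|d]; first by apply/pm/qm.
  rewrite inE => /predU1P[->|ds] i j ij; first exact: hpsi.
  apply: (IH d ds); move: ij; rewrite leq_eqVlt => /predU1P[->//|ij].
  exact/ltnW/qm.
exists (phi 0%N), (phi 1%N); split; first exact: pmono.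
by apply/mnm_lepP => c; apply: hphi; rewrite ?mem_enum.
Qed.

(** Without a finite generating list, elements of [U] divisible by no earlier choice could be picked
    forever, against [dickson]. *)
Lemma dickson_generators (n : nat) (U : 'X_{1..n} -> Prop) :
  exists2 G : seq 'X_{1..n}, {in G, forall g, U g} &
    forall a, U a -> exists2 g, g \in G & (g <= a)%MM.
Proof.
apply: contrapT => noG.
(* The condition on [G] stands under the existential so that [choice] gives a function on all
   lists. *)
have step (G : seq 'X_{1..n}) : exists a, {in G, forall g, U g} ->
    U a /\ {in G, forall g, ~~ (g <= a)%MM}.
  have [GU|nGU] := pselect {in G, forall g, U g}; last by exists 0%MM => /nGU.
  apply: contrapT => noa; apply: noG; exists G => // a Ua.
  apply: contrapT => nog; apply: noa; exists a => _; split=> // g gG.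
  by apply/negP => ga; apply: nog; exists g.
have [f hf] := choice step.
pose fix L k := if k is k'.+1 then f (L k') :: L k' else [::].
have LU k : {in L k, forall g, U g}.
  elim: k => //= k IH g; rewrite inE => /predU1P[->|/IH//].
  by have [] := hf _ IH.
have Lsub i j : (i < j)%N -> f (L i) \in L j.
  elim: j => // j IH; rewrite ltnS leq_eqVlt /= inE => /predU1P[->|/IH ->].
    by rewrite eqxx.
  by rewrite orbT.
have [i [j [ij]]] := dickson (fun k => f (L k)).
by have [_ /(_ _ (Lsub _ _ ij)) /negP] := hf _ (LU j).
Qed.

(** The variable of index 0 is the homogenizing one; its truncated exponent is the intended one when
    [mdeg a <= m]. *)
Definition mnm_homog (n m : nat) (a : 'X_{1..n}) : 'X_{1..n.+1} :=
  [multinom oapp a (m - mdeg a)%N (unlift ord0 i) | i < n.+1].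

Definition mnm_dehomog (n : nat) (c : 'X_{1..n.+1}) : 'X_{1..n} :=
  [multinom c (lift ord0 j) | j < n].

Lemma mdeg_dehomog n (c : 'X_{1..n.+1}) : mdeg c = (c ord0 + mdeg (mnm_dehomog c))%N.
Proof.
by rewrite !mdegE big_ord_recl; congr addn; apply: eq_bigr => i _; rewrite mnmE.
Qed.

Lemma mnm_homogK n m : cancel (@mnm_homog n m) (@mnm_dehomog n).
Proof. by move=> a; apply/mnmP => i; rewrite !mnmE liftK. Qed.

Lemma mdeg_homog n m (a : 'X_{1..n}) : (mdeg a <= m)%N -> mdeg (mnm_homog m a) = m.
Proof. by move=> am; rewrite mdeg_dehomog mnm_homogK mnmE unlift_none /= subnK. Qed.

Lemma mnm_dehomogK n m (c : 'X_{1..n.+1}) :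
  mdeg c = m -> mnm_homog m (mnm_dehomog c) = c.
Proof.
move=> cm; apply/mnmP => i; rewrite mnmE; case: unliftP => [j ->|->] /=.
  by rewrite mnmE.
by rewrite -cm mdeg_dehomog addnK.
Qed.

(** Homogenization matches the monomials of degree at most [m] in [n] variables with those of degree
    exactly [m] in [n.+1] variables. *)
Lemma card_bmultinom n m : #|{: 'X_{1..n < m.+1}}| = 'C(m + n, n).
Proof.
rewrite -bin_sub ?leq_addl // addnK -(size_basis n m).
rewrite cardE -(size_map (fun a : 'X_{1..n < m.+1} => mnm_homog m a)).
apply/perm_size/uniq_perm; last 2 first.
- exact: uniq_basis.
- move=> c; rewrite -basis_cover; apply/mapP/eqP => [[a _ ->]|cm].
    by rewrite mdeg_homog // -ltnS bmdeg.
  have cb : (mdeg (mnm_dehomog c) < m.+1)%N by rewrite ltnS -cm mdeg_dehomog leq_addl.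
  by exists (BMultinom cb); rewrite ?mem_enum //= mnm_dehomogK.
rewrite map_inj_uniq ?enum_uniq // => a b /(can_inj (@mnm_homogK _ _)).
exact: val_inj.
Qed.

(** For [l = 0] this is the affine Hilbert function of the quotient by the monomial ideal of [G];
    other [l] arise as least common multiples in the induction. *)
Definition avoid_count n (G : seq 'X_{1..n}) (l : 'X_{1..n}) (m : nat) : nat :=
  #|[set a : 'X_{1..n < m.+1} | (l <= a)%MM && all (fun g => ~~ (g <= a)%MM) G]|.

Lemma binomial_poly (n : nat) : exists P : {poly rat},
  forall m : nat, P.[m%:R] = 'C(m + n, n)%:R.
Proof.
exists ((n`!%:R)^-1 *: \prod_(i < n) ('X + (n - i)%:R%:P)) => m.
rewrite hornerZ horner_prod.
have -> : \prod_(i < n) ('X + (n - i)%:R%:P).[m%:R] = ((m + n) ^_ n)%:R :> rat.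
  rewrite ffact_prod natr_prod; apply: eq_bigr => i _.
  by rewrite hornerD hornerX hornerC -natrD addnBA // ltnW.
by rewrite -bin_ffact natrM mulrC mulfK // pnatr_eq0 -lt0n fact_gt0.
Qed.

(* Induction on the generators: splitting off [g] gives
   [avoid_count (g :: G) l = avoid_count G l - avoid_count G (mlcm l g)]. *)
Lemma avoid_count_poly n (G : seq 'X_{1..n}) (l : 'X_{1..n}) :
  exists P : {poly rat}, eventually (fun m => P.[m%:R] = (avoid_count G l m)%:R).
Proof.
elim: G l => [|g G IH] l.
  have [P hP] := binomial_poly n.
  exists (P \Po ('X - (mdeg l)%:R%:P)), (mdeg l) => m lm.
  rewrite horner_comp hornerD hornerN hornerX hornerC -natrB // hP.
  rewrite -card_bmultinom; congr (_%:R).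
  have hadd (a : 'X_{1..n < (m - mdeg l).+1}) : (mdeg (l + a)%MM < m.+1)%N.
    by have := bmdeg a; rewrite mdegD; lia.
  rewrite /avoid_count -(card_imset (f := fun a => BMultinom (hadd a))); last first.
    by move=> a b /(congr1 val) /= /addmI h; apply: val_inj.
  apply: eq_card => a; rewrite inE /= andbT; apply/imsetP/idP => [[b _ ->]|la].
    by rewrite /= lem_addr.
  have hsub : (mdeg (a - l)%MM < (m - mdeg l).+1)%N.
    have := bmdeg a; rewrite -{1}(submK la) mdegD; lia.
  by exists (BMultinom hsub) => //; apply: val_inj; rewrite /= addmC submK.
have [P hP] := IH l; have [Q hQ] := IH (mlcm l g).
exists (P - Q); apply: eventually_imp (eventually_and hP hQ) => m [h1 h2].
rewrite hornerD hornerN h1 h2; apply/eqP; rewrite subr_eq -natrD eqr_nat; apply/eqP.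
rewrite /avoid_count -(cardsID [set a : 'X_{1..n < m.+1} | (g <= a)%MM]) addnC.
congr addn; apply: eq_card => a; rewrite !inE.
  by rewrite andbCA andbA.
by rewrite lem_mlcm -!andbA; congr andb; rewrite andbC.
Qed.

(** * Normal forms and Hilbert functions *)

Definition is_prime_ideal (R : comNzRingType) (P : set R) : Prop :=
  [/\ is_ideal P, ~ P 1 & forall f g, P (f * g) -> P f \/ P g].

Section Ideals.
Variables (R : comNzRingType) (P : set R).
Hypothesis Pid : is_ideal P.

Lemma ideal0 : P 0. Proof. by case: Pid. Qed.

Lemma idealD f g : P f -> P g -> P (f + g). Proof. by case: Pid => _ h _; exact: h. Qed.

Lemma ideal_mull a f : P f -> P (a * f). Proof. by case: Pid => _ _ h; exact: h. Qed.

Lemma ideal_mulr a f : P f -> P (f * a). Proof. by rewrite mulrC; exact: ideal_mull. Qed.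

Lemma idealN f : P f -> P (- f). Proof. by rewrite -mulN1r; exact: ideal_mull. Qed.

Lemma idealB f g : P f -> P g -> P (f - g).
Proof. by move=> Pf Pg; apply: idealD => //; exact: idealN. Qed.

Lemma idealBC f g : P (f - g) -> P (g - f).
Proof. by move=> h; rewrite -opprB; exact: idealN. Qed.

Lemma ideal_trans g f h : P (f - g) -> P (g - h) -> P (f - h).
Proof. by move=> h1 h2; rewrite -(subrKA g); exact: idealD. Qed.

Lemma ideal_sum (I : Type) (r : seq I) (A : pred I) (F : I -> R) :
  (forall i, A i -> P (F i)) -> P (\sum_(i <- r | A i) F i).
Proof. by move=> h; apply: big_ind => //; [exact: ideal0 | exact: idealD]. Qed.

End Ideals.

Lemma prime_idealX (R : comNzRingType) (P : set R) f n :
  is_prime_ideal P -> P (f ^+ n) -> P f.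
Proof.
case=> Pid P1 PM; elim: n => [|n IH]; first by rewrite expr0 => /P1.
by rewrite exprS => /PM [].
Qed.

Lemma msize_leq_mlead (n : nat) (K : nzRingType) (f g : {mpoly K[n]}) :
  f != 0 -> (mlead g <= mlead f)%O -> (msize g <= msize f)%N.
Proof.
move=> f0 gf; have [->|g0] := eqVneq g 0; first by rewrite msize0.
by rewrite -!mlead_deg // ltnS lemc_mdeg.
Qed.

Lemma msizeB_leq (n : nat) (K : nzRingType) (f g : {mpoly K[n]}) b :
  (msize f <= b)%N -> (msize g <= b)%N -> (msize (f - g) <= b)%N.
Proof.
move=> fb gb; apply: (leq_trans (msizeD_le _ _)).
by rewrite geq_max msizeN fb.
Qed.

Lemma msize_sum_leq (n : nat) (K : nzRingType) (I : Type) (r : seq I) (A : pred I)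
    (F : I -> {mpoly K[n]}) b :
  (forall i, A i -> (msize (F i) <= b)%N) -> (msize (\sum_(i <- r | A i) F i) <= b)%N.
Proof.
move=> h; apply: (big_ind (fun f => msize f <= b)%N) => //; first by rewrite msize0.
by move=> x y xb yb; apply: (leq_trans (msizeD_le _ _)); rewrite geq_max xb.
Qed.

Lemma msizeM_leq (n : nat) (K : idomainType) (f g : {mpoly K[n]}) a b :
  (msize f <= a.+1)%N -> (msize g <= b.+1)%N -> (msize (f * g) <= (a + b).+1)%N.
Proof.
move=> fa gb; have [->|f0] := eqVneq f 0; first by rewrite mul0r msize0.
have [->|g0] := eqVneq g 0; first by rewrite mulr0 msize0.
by rewrite msizeM //; lia.
Qed.

Section NormalForms.
Variables (N : nat) (k : fieldType) (P : set {mpoly k[N]}).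
Hypothesis Pid : is_ideal P.

(** The monomials outside the ideal of leading monomials; their classes form a basis of the quotient
    by [P]. *)
Definition standard (a : 'X_{1..N}) : bool :=
  ~~ `[< exists f, [/\ P f, f != 0 & mlead f = a] >].

Definition is_normal_form (f g : {mpoly k[N]}) : Prop :=
  [/\ P (f - g), {in msupp g, forall a, standard a} & (msize g <= msize f)%N].

Definition normal_form (f : {mpoly k[N]}) : {mpoly k[N]} := xget 0 (is_normal_form f).

Lemma idealZ c f : P f -> P (c *: f).
Proof. by rewrite -mul_mpolyC; exact: ideal_mull. Qed.

Lemma standard_le (a b : 'X_{1..N}) : (a <= b)%MM -> standard b -> standard a.
Proof.
move=> ab; apply: contraNN => /asboolP[f [Pf f0 fa]]; apply/asboolP.
exists (f * 'X_[b - a]); split; first exact: ideal_mulr.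
  by rewrite mulf_neq0 // -msupp_eq0 msuppX.
by rewrite mleadM -?msupp_eq0 ?msuppX // ?msupp_eq0 // mleadXm fa addmC submK.
Qed.

Lemma normal_form_unique g g' : {in msupp g, forall a, standard a} ->
  {in msupp g', forall a, standard a} -> P (g - g') -> g = g'.
Proof.
move=> sg sg' Pgg'; apply/eqP; rewrite -subr_eq0; apply/negPn/negP => d0.
have : standard (mlead (g - g')).
  have /msuppB_le := mlead_supp d0; rewrite mem_cat => /orP[/sg|/sg'] //.
by move/asboolP; apply; exists (g - g').
Qed.

(** Division by leading monomials, by induction on [mlead f]: a leading term that occurs in [P] is
    cancelled, a standard one is set aside. The monomial order is graded, so sizes do not grow. *)
Lemma normal_form_exists f : exists g, is_normal_form f g.
Proof.
elim/mleadrect: f => f IH.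
have [->|f0] := eqVneq f 0.
  by exists 0; split; rewrite ?subr0 // ?msupp0 //; exact: ideal0.
set a := mlead f.
have [la|sa] := boolP `[< exists f, [/\ P f, f != 0 & mlead f = a] >].
  case/asboolP: la => h [Ph h0 ha].
  have hc0 : mleadc h != 0 by rewrite mleadc_eq0.
  set c := mleadc f / mleadc h; set f' := f - c *: h.
  have c0 : c != 0 by rewrite mulf_neq0 ?invr_neq0 // mleadc_eq0.
  have lec : (mlead f' <= a)%O.
    by apply: (le_trans (mleadB_le _ _)); rewrite mleadZ // ha -/a joinxx.
  have [f'0|f'0] := eqVneq f' 0.
    exists 0; split; rewrite ?msupp0 ?msize0 // subr0.
    have -> : f = c *: h by apply/eqP; rewrite -subr_eq0 -/f' f'0.
    exact: idealZ.
  have f'a : f'@_a = 0.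
    have hca : h@_a = mleadc h by rewrite ha.
    by rewrite mcoeffB mcoeffZ hca divfK // subrr.
  have /IH [g [Pg sg szg]] : (mlead f' < a)%O.
    rewrite lt_neqAle lec andbT; apply/eqP => e.
    by move: f'0; rewrite -mleadc_eq0 e f'a eqxx.
  exists g; split=> //.
    apply: (ideal_trans Pid (g := f')) Pg.
    by rewrite opprB addrC subrK; exact: idealZ.
  exact/(leq_trans szg)/msize_leq_mlead.
set f' := f - f@_a *: 'X_[a].
have X0 : ('X_[a] : {mpoly k[N]}) != 0 by rewrite -msupp_eq0 msuppX.
have fa0 : f@_a != 0 by rewrite mleadc_eq0.
have szX : (msize (f@_a *: 'X_[a]) <= msize f)%N.
  by rewrite msizeZ // msizeX mlead_deg.
have [f'0|f'0] := eqVneq f' 0.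
  have fE : f = f@_a *: 'X_[a] by apply/eqP; rewrite -subr_eq0 -/f' f'0.
  exists f; split=> //; first by rewrite subrr; exact: ideal0.
  by move=> b; rewrite fE msuppMCX // inE => /eqP ->.
have /IH [g [Pg sg szg]] : (mlead f' < a)%O by exact: ltm_mleadD.
exists (g + f@_a *: 'X_[a]); split.
- by rewrite opprD addrA addrAC.
- move=> b /msuppD_le; rewrite mem_cat => /orP[/sg //|].
  by rewrite msuppMCX // inE => /eqP ->.
- apply: (leq_trans (msizeD_le _ _)); rewrite geq_max szX andbT.
  by rewrite (leq_trans szg) // msizeB_leq.
Qed.

Lemma normal_formP f : is_normal_form f (normal_form f).
Proof. by have [g hg] := normal_form_exists f; exact: (xgetPex 0 (ex_intro _ g hg)). Qed.

Lemma normal_form_eq f g : P (f - g) -> normal_form f = normal_form g.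
Proof.
move=> Pfg; have [Pf sf _] := normal_formP f; have [Pg sg _] := normal_formP g.
apply: normal_form_unique => //.
apply: (ideal_trans Pid) (ideal_trans Pid Pfg Pg).
exact: idealBC.
Qed.

Lemma normal_form_id g : {in msupp g, forall a, standard a} -> normal_form g = g.
Proof.
move=> sg; have [Pg sg' _] := normal_formP g.
by apply: normal_form_unique => //; exact: idealBC.
Qed.

Lemma normal_form_eqP f g : normal_form f = normal_form g -> P (f - g).
Proof.
move=> e; have [Pf _ _] := normal_formP f; have [Pg _ _] := normal_formP g.
by apply: (ideal_trans Pid Pf); rewrite e; exact: idealBC.
Qed.

Lemma normal_form_linear : linear normal_form.
Proof.
move=> c f g; have [Pf sf _] := normal_formP f; have [Pg sg _] := normal_formP g.
have [Ph sh _] := normal_formP (c *: f + g).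
apply: normal_form_unique => //.
  move=> a /msuppD_le; rewrite mem_cat => /orP[|/sg //].
  by move=> /msuppZ_le /sf.
apply: (ideal_trans Pid); first exact: idealBC Ph.
rewrite opprD addrACA -scalerBr; apply: idealD => //.
exact: idealZ.
Qed.

Definition std_mon (b : nat) : Type := {a : 'X_{1..N < b} | standard a}.

HB.instance Definition _ b := Finite.on (std_mon b).

Definition std_mnm b (a : std_mon b) : 'X_{1..N} := bmnm (sval a).

Lemma std_mnm_inj b : injective (@std_mnm b).
Proof. by move=> a a' e; apply/val_inj/val_inj. Qed.

(** Macaulay's form of the affine Hilbert function: since the order is graded, the standard
    monomials of degree below [b] are a basis of the polynomials of degree below [b] modulo [P]. *)
Definition hilb (b : nat) : nat := #|[set a : 'X_{1..N < b} | standard a]|.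

Lemma card_std_mon b : #|{: std_mon b}| = hilb b.
Proof. by rewrite card_sig /hilb cardsE. Qed.

Definition nf_coords b (f : {mpoly k[N]}) : {ffun std_mon b -> k} :=
  [ffun a => (normal_form f)@_(std_mnm a)].

Definition of_coords b (c : {ffun std_mon b -> k}) : {mpoly k[N]} :=
  \sum_a c a *: 'X_[std_mnm a].

Lemma mcoeff_of_coords b (c : {ffun std_mon b -> k}) (a : std_mon b) :
  (of_coords c)@_(std_mnm a) = c a.
Proof.
rewrite raddf_sum (bigD1 a) //= mcoeffZ mcoeffX eqxx mulr1 big1 ?addr0 // => a' ne.
rewrite mcoeffZ mcoeffX; case: eqP => [/std_mnm_inj e|_]; last by rewrite mulr0.
by rewrite e eqxx in ne.
Qed.

Lemma msupp_of_coords b (c : {ffun std_mon b -> k}) (a : 'X_{1..N}) :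
  a \in msupp (of_coords c) -> standard a /\ (mdeg a < b)%N.
Proof.
rewrite mcoeff_msupp => ha.
have [a' e] : exists a' : std_mon b, a = std_mnm a'.
  apply: contrapT => na; move: ha; rewrite raddf_sum /= big1 ?eqxx // => a' _.
  rewrite mcoeffZ mcoeffX; case: eqP => [e|_]; last by rewrite mulr0.
  by case: na; exists a'.
by rewrite e; split; [exact: (valP a') | exact: bmdeg].
Qed.

Lemma msize_of_coords b (c : {ffun std_mon b -> k}) : (msize (of_coords c) <= b)%N.
Proof.
apply: msize_sum_leq => a _; apply: (leq_trans (msizeZ_le _ _)).
by rewrite msizeX bmdeg.
Qed.

Lemma of_coords_inj b (c c' : {ffun std_mon b -> k}) :
  P (of_coords c - of_coords c') -> c = c'.
Proof.
move/normal_form_unique => e; apply/ffunP => a.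
rewrite -!mcoeff_of_coords e // => x /msupp_of_coords [] //.
Qed.

Lemma nf_coordsK b f : (msize f <= b)%N -> of_coords (nf_coords b f) = normal_form f.
Proof.
move=> fb; have [Pf sf szf] := normal_formP f.
apply/mpolyP => a.
have [sa|nsa] := boolP (standard a && (mdeg a < b)%N).
  case/andP: sa => sa ab.
  pose a' : std_mon b := exist _ (BMultinom ab) sa.
  by rewrite (mcoeff_of_coords _ a') ffunE.
rewrite !memN_msupp_eq0 //; apply/negP.
  move=> ha; move: nsa; rewrite (sf _ ha) /= => /negP; apply.
  exact: leq_trans (msize_mdeg_lt ha) (leq_trans szf fb).
by move/msupp_of_coords => [h1 h2]; rewrite h1 h2 in nsa.
Qed.

Lemma nf_coords_eq b f g : (msize f <= b)%N -> (msize g <= b)%N ->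
  nf_coords b f = nf_coords b g -> P (f - g).
Proof. by move=> fb gb e; apply: normal_form_eqP; rewrite -!(@nf_coordsK b) // e. Qed.

(** The monomial 1 is standard, because a polynomial led by it is a nonzero constant, hence a
    unit. *)
Lemma hilb_gt0 b : ~ P 1 -> (0 < hilb b.+1)%N.
Proof.
have h0 : (mdeg (0%MM : 'X_{1..N}) < b.+1)%N by rewrite mdeg0.
move=> P1; apply/card_gt0P; exists (BMultinom h0); rewrite inE /=.
apply/asboolP => -[f [Pf f0 fl]]; apply: P1.
have : (msize f <= 1)%N by rewrite -mlead_deg // fl mdeg0.
move/msize1_polyC => e.
have c0 : f@_0%MM != 0 by move: f0; rewrite -mleadc_eq0 fl.
have -> : 1 = ((f@_0%MM)^-1)%:MP * f by rewrite {2}e -mpolyCM mulVf.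
exact: ideal_mull.
Qed.

Lemma hilb_le_binomial m : (hilb m.+1 <= 'C(m + N, N))%N.
Proof. by rewrite -card_bmultinom max_card. Qed.

End NormalForms.

(** * Dimension estimates by counting over a finite field *)

Section CountHilbert.
Variables (N : nat) (k : finFieldType).
Implicit Type P : set {mpoly k[N]}.

Lemma card_coords P b : #|{ffun std_mon P b -> k}| = (#|k| ^ hilb P b)%N.
Proof. by rewrite card_ffun card_std_mon. Qed.

(** The polynomials of size at most [b] have [#|k| ^ hilb P b] residue classes modulo [P], so
    counting pairwise incongruent families replaces linear algebra. *)
Lemma card_le_hilb P b (E : finType) (phi : E -> {mpoly k[N]}) : is_ideal P ->
  (forall e, (msize (phi e) <= b)%N) -> (forall e e', P (phi e - phi e') -> e = e') ->
  (#|E| <= #|k| ^ hilb P b)%N.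
Proof.
move=> Pid szphi phi_inj; rewrite -card_coords.
apply: (leq_card (fun e => nf_coords P b (phi e))) => e e' /nf_coords_eq h.
by apply: phi_inj; exact: h.
Qed.

Lemma leq_hilb P b n : is_ideal P -> (#|k| ^ n <= #|k| ^ hilb P b)%N = (n <= hilb P b)%N.
Proof. by move=> Pid; rewrite leq_exp2l // card_finNzRing_gt1. Qed.

End CountHilbert.

(** [hilb] bounds degrees strictly, hence the shift: the value at [m] concerns polynomials of degree
    at most [m]. *)
Definition is_hilbert_poly N (k : fieldType) (P : set {mpoly k[N]}) (H : {poly rat}) :=
  eventually (fun m => H.[m%:R] = (hilb P m.+1)%:R).

Section HilbertPolynomial.
Variables (N : nat) (k : fieldType).
Implicit Type P : set {mpoly k[N]}.

(** By Dickson's lemma the standard monomials are those that avoid finitely many divisors. *)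
Lemma hilbert_poly_exists P : is_ideal P -> exists H, is_hilbert_poly P H.
Proof.
move=> Pid.
have [G GU hG] := dickson_generators (fun a : 'X_{1..N} => ~~ standard P a).
have [H hH] := avoid_count_poly G 0%MM; exists H.
apply: eventually_imp hH => m ->; congr (_%:R); apply: eq_card => a; rewrite !inE.
have -> /= : (0 <= a)%MM by apply/mnm_lepP => i; rewrite mnm0E.
apply/allP/idP => [h|sa g gG].
  by apply: contraT => /hG [g /h /negP].
by apply/negP => ga; move/GU: gG => /negP; apply; exact: standard_le sa.
Qed.

Lemma hilbert_poly_lead_gt0 P H : is_ideal P -> ~ P 1 ->
  is_hilbert_poly P H -> 0 < lead_coef H.
Proof.
move=> Pid P1 hH; rewrite lt_neqAle eq_sym lead_coef_eq0; apply/andP; split.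
  apply/eqP => H0; have [m] := eventually_ex hH.
  move/eqP; rewrite H0 horner0 eq_sym pnatr_eq0 => /eqP e.
  by have := hilb_gt0 Pid m P1; rewrite e.
by apply: lead_coef_ge0_eventually; apply: eventually_imp hH => m ->.
Qed.

End HilbertPolynomial.

(** The map sending [(u, v)] to [f * u + v] is injective modulo [P]: modulo [Q] only [v] survives,
    and then [f] cancels because [P] is prime. *)
Lemma hilb_add_le N (k : finFieldType) (P Q : set {mpoly k[N]}) f b :
  is_prime_ideal P -> is_ideal Q -> (P `<=` Q)%classic -> Q f -> ~ P f ->
  (hilb P b + hilb Q (b + (msize f).-1) <= hilb P (b + (msize f).-1))%N.
Proof.
move=> [Pid P1 PM] Qid PQ Qf Pf; set d := (msize f).-1.
have f0 : f != 0 by apply/eqP => f0; apply: Pf; rewrite f0; exact: ideal0.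
rewrite -(leq_hilb _ _ Pid) expnD -(card_coords P b) -(card_coords Q) -card_prod.
pose phi (e : {ffun std_mon P b -> k} * {ffun std_mon Q (b + d) -> k}) :=
  f * of_coords e.1 + of_coords e.2.
apply: (card_le_hilb (phi := phi) Pid); rewrite {}/phi.
  move=> [u v] /=; apply: (leq_trans (msizeD_le _ _)).
  rewrite geq_max msize_of_coords andbT.
  have [->|u0] := eqVneq (of_coords u) 0; first by rewrite mulr0 msize0.
  by rewrite msizeM //; move: (msize_of_coords u); rewrite /d;
     move: (msize (of_coords u)) (msize f) => x y; lia.
move=> [u v] [u' v'] /=; rewrite opprD addrACA -mulrBr => h.
have ev : v = v'.
  apply: (of_coords_inj (P := Q)).
  have := idealB Qid (PQ _ h) (ideal_mulr Qid (of_coords u - of_coords u') Qf).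
  by rewrite addrAC subrr add0r.
move: h; rewrite ev subrr addr0 => /PM [//|/of_coords_inj -> //].
Qed.

(** A shift of the argument preserves the size and the leading coefficient, which therefore
    cancels. *)
Lemma size_comp_shift_sub (H : {poly rat}) c : H != 0 ->
  (size (H \Po ('X + c%:P) - H)%R < size H)%N.
Proof.
move=> H0.
have szq : size ('X + c%:P : {poly rat}) = 2 by rewrite size_XaddC.
have szc : size (H \Po ('X + c%:P)) = size H by rewrite size_comp_poly2.
rewrite -[X in (_ < X)%N]prednK ?size_poly_gt0 // ltnS; apply/leq_sizeP => j.
rewrite leq_eqVlt => /predU1P[<-|]; rewrite coefB.
  rewrite -{1}szc -!lead_coefE lead_coef_comp ?szq // lead_coefXaddC expr1n mulr1.
  by rewrite subrr.
by rewrite prednK ?size_poly_gt0 // => hj; rewrite !nth_default ?szc // subrr.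
Qed.

(** By [hilb_add_le], [HQ] at [m + d] is at most the difference of [HP] at [m + d] and at [m], a
    polynomial of smaller degree than [HP]. *)
Lemma size_hilbert_poly_lt N (k : finFieldType) (P Q : set {mpoly k[N]}) HP HQ :
  is_prime_ideal P -> is_ideal Q -> ~ Q 1 -> (P `<` Q)%classic ->
  is_hilbert_poly P HP -> is_hilbert_poly Q HQ -> (size HQ < size HP)%N.
Proof.
move=> Ppr Qid Q1 [PQ nQP] hP hQ; have [Pid P1 _] := Ppr.
have [f Qf Pf] : exists2 f, Q f & ~ P f.
  apply: contrapT => nf; apply: nQP => f Qf; apply: contrapT => Pf.
  by apply: nf; exists f.
set d := (msize f).-1.
have HP0 : HP != 0 by rewrite -lead_coef_eq0 gt_eqF // (hilbert_poly_lead_gt0 Pid P1 hP).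
apply: leq_ltn_trans (size_comp_shift_sub d%:R HP0).
have <- : size (HQ \Po ('X + d%:R%:P)) = size HQ by rewrite size_comp_poly2 // size_XaddC.
apply: size_le_eventually.
  rewrite lead_coef_comp ?size_XaddC // lead_coefXaddC expr1n mulr1.
  exact: (hilbert_poly_lead_gt0 Qid Q1 hQ).
have shift A : eventually A -> eventually (fun m => A (m + d)%N).
  by apply: eventually_comp => m; exact: leq_addr.
apply: eventually_imp (eventually_and hP (eventually_and (shift _ hP) (shift _ hQ))).
move=> m [h1 [h2 h3]].
rewrite hornerD hornerN !horner_comp !hornerE -!natrD h1 h2 h3 lerBrDr -natrD ler_nat addnC.
by rewrite -addSn; exact: hilb_add_le.
Qed.

(** The bound ['C(m + N, N)] is at most [(m + N) ^ N], which is polynomial in [m] of degree [N]. *)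
Lemma size_hilbert_poly_le N (k : fieldType) (P : set {mpoly k[N]}) H :
  is_ideal P -> ~ P 1 -> is_hilbert_poly P H -> (size H <= N.+1)%N.
Proof.
move=> Pid P1 hP; have lH := hilbert_poly_lead_gt0 Pid P1 hP.
have szN : size (('X + N%:R%:P : {poly rat}) ^+ N) = N.+1.
  by rewrite -[N%:R%:P]opprK -polyCN size_exp_XsubC.
rewrite -szN; apply: size_le_eventually => //.
apply: eventually_imp hP => m ->.
rewrite horner_exp !hornerE -natrD -natrX ler_nat.
apply: (leq_trans (hilb_le_binomial _ _)).
rewrite -(leq_pmul2r (fact_gt0 N)) bin_ffact.
apply: (@leq_trans ((m + N) ^ N)%N); last by rewrite leq_pmulr // fact_gt0.
rewrite ffact_prod -[X in (_ <= _ ^ X)%N]card_ord -prod_nat_const.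
by apply: leq_prod => i _; exact: leq_subr.
Qed.

Lemma msize_exp_leq (n : nat) (K : idomainType) (f : {mpoly K[n]}) a m :
  (msize f <= a.+1)%N -> (msize (f ^+ m) <= (m * a).+1)%N.
Proof.
move=> fa; elim: m => [|m IH]; first by rewrite expr0 msize1.
by rewrite exprS mulSn; exact: msizeM_leq.
Qed.

Lemma msize_prod_leq (n : nat) (K : idomainType) (I : Type) (r : seq I) (A : pred I)
    (F : I -> {mpoly K[n]}) (d : I -> nat) :
  (forall i, A i -> (msize (F i) <= (d i).+1)%N) ->
  (msize (\prod_(i <- r | A i) F i) <= (\sum_(i <- r | A i) d i).+1)%N.
Proof.
move=> h; elim/big_rec2: _ => [|i a f Ai IH]; first by rewrite msize1.
by apply: msizeM_leq => //; exact: h.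
Qed.

(** * Translation of a rational point to the origin *)

Section Translation.
Variables (N : nat) (k : fieldType).
Implicit Types (s : 'I_N -> k) (f : {mpoly k[N]}) (P : set {mpoly k[N]}).

Definition translate s f : {mpoly k[N]} := f \mPo [tuple 'X_i + (s i)%:MP | i < N].

HB.instance Definition _ s := GRing.RMorphism.copy (translate s)
  (comp_mpoly [tuple 'X_i + (s i)%:MP | i < N]).

Lemma translateZ s c f : translate s (c *: f) = c *: translate s f.
Proof. exact: comp_mpolyZ. Qed.

Lemma translate_sum s (I : Type) (r : seq I) (A : pred I) (F : I -> {mpoly k[N]}) :
  translate s (\sum_(i <- r | A i) F i) = \sum_(i <- r | A i) translate s (F i).
Proof. exact: rmorph_sum. Qed.

Lemma translateC s c : translate s c%:MP = c%:MP.
Proof. exact: comp_mpolyC. Qed.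

Lemma translateXU s i : translate s 'X_i = 'X_i + (s i)%:MP.
Proof. by rewrite /translate comp_mpolyXU -tnth_nth tnth_mktuple. Qed.

Lemma translateX s (m : 'X_{1..N}) :
  translate s 'X_[m] = \prod_(i < N) ('X_i + (s i)%:MP) ^+ m i.
Proof.
by rewrite /translate comp_mpolyX; apply: eq_bigr => i _; rewrite tnth_mktuple.
Qed.

Lemma translateK s : cancel (translate s) (translate (fun i => - s i)).
Proof.
move=> f; rewrite [f in LHS]mpolyE [f in RHS]mpolyE [translate s _]translate_sum translate_sum; apply: eq_bigr => m _.
rewrite /= !translateZ translateX rmorph_prod mpolyXE_id; congr (_ *: _).
apply: eq_bigr => i _; rewrite rmorphXn rmorphD /= translateXU translateC.
by rewrite mpolyCN subrK.
Qed.

Lemma msize_translate s f : (msize (translate s f) <= msize f)%N.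
Proof.
rewrite [f in translate s f]mpolyE translate_sum big_seq.
apply: msize_sum_leq => m /msize_mdeg_lt mf; rewrite translateZ.
apply: (leq_trans (msizeZ_le _ _)); apply: leq_trans mf.
rewrite translateX mdegE; apply: msize_prod_leq => i _.
rewrite -[X in (_ <= X.+1)%N]muln1; apply: msize_exp_leq.
apply: (leq_trans (msizeD_le _ _)); rewrite geq_max msizeX mdeg1 /= msizeC.
by case: (_ != _).
Qed.

Lemma mcoeff0_meval f : f@_0%MM = f.@[fun=> 0].
Proof.
rewrite mevalE [f in LHS]mpolyE raddf_sum; apply: eq_bigr => m _ /=.
rewrite mcoeffZ mcoeffX; congr (_ * _).
have [->|m0] := eqVneq m 0%MM.
  by rewrite big1 // => i _; rewrite mnm0E expr0.
have [i mi] : exists i, m i != 0%N.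
  apply: contrapT => nm; move/eqP: m0; apply; apply/mnmP => i; rewrite mnm0E.
  by apply/eqP/negPn/negP => mi; apply: nm; exists i.
by rewrite (bigD1 i) //= expr0n (negPf mi) mul0r.
Qed.

Lemma mcoeff0_translate s f : (translate s f)@_0%MM = f.@[s].
Proof.
rewrite mcoeff0_meval comp_mpoly_meval; apply: meval_eq => i.
by rewrite tnth_mktuple mevalD mevalXU mevalC add0r.
Qed.

(** The image of [P] under [translate s], written as a preimage under the inverse; a zero [s] of [P]
    becomes the origin. *)
Definition translate_ideal s P : set {mpoly k[N]} :=
  fun f => P (translate (fun i => - s i) f).

Lemma translate_ideal_prime s P : is_prime_ideal P -> is_prime_ideal (translate_ideal s P).
Proof.
move=> [[P0 PD PMl] P1 PM]; rewrite /translate_ideal; split; first split.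
- by rewrite rmorph0.
- by move=> f g h1 h2; rewrite rmorphD; exact: PD.
- by move=> a f h; rewrite rmorphM; exact: PMl.
- by rewrite rmorph1.
- by move=> f g; rewrite rmorphM => /PM.
Qed.

Lemma translate_idealP s P f : translate_ideal s P (translate s f) <-> P f.
Proof. by rewrite /translate_ideal translateK. Qed.

Lemma translateNK s : cancel (translate (fun i => - s i)) (translate s).
Proof.
move=> f; have := translateK (fun i => - s i) f.
by congr (translate _ _ = _); apply/funext => i; rewrite opprK.
Qed.

End Translation.

(** Translations in both directions keep the degree bound and are injective on residue classes. *)
Lemma hilb_translate N (k : finFieldType) (s : 'I_N -> k) (P : set {mpoly k[N]}) b :
  is_ideal P -> is_ideal (translate_ideal s P) -> hilb (translate_ideal s P) b = hilb P b.
Proof.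
move=> Pid P'id; apply/eqP; rewrite eqn_leq; apply/andP; split.
  rewrite -(leq_hilb _ _ Pid) -[X in (X <= _)%N]card_coords.
  apply: (card_le_hilb (phi := fun c => translate (fun i => - s i) (of_coords c))) => //.
    by move=> c; apply: (leq_trans (msize_translate _ _)); exact: msize_of_coords.
  by move=> c c'; rewrite -rmorphB => h; apply: of_coords_inj h.
rewrite -(leq_hilb _ _ P'id) -[X in (X <= _)%N]card_coords.
apply: (card_le_hilb (phi := fun c => translate s (of_coords c))) => //.
  by move=> c; apply: (leq_trans (msize_translate _ _)); exact: msize_of_coords.
by move=> c c'; rewrite -rmorphB => /translate_idealP h; apply: of_coords_inj h.
Qed.

(** * Frobenius powers *)

(** Lagrange's theorem in the group of units, which has order [#|k|.-1]. *)
Lemma expf_card_finField (k : finFieldType) (x : k) : x ^+ #|k| = x.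
Proof.
have [->|x0] := eqVneq x 0; first by rewrite expr0n gtn_eqF // ltnW ?card_finNzRing_gt1.
have Ux : x \is a GRing.unit by rewrite unitfE.
have h : #|[set: {unit k}]| = #|k|.-1.
  by rewrite -(cardC1 (0 : k)) cardsT card_sub; apply: eq_card => y; rewrite unitfE.
rewrite -(ltn_predK (card_finNzRing_gt1 k)) exprS -h.
have : (FinRing.unit k Ux ^+ #|[set: {unit k}]| = 1)%g.
  by apply/eqP; rewrite -order_dvdn order_dvdG ?inE.
move/(congr1 val).
by rewrite FinRing.val_unitX FinRing.val_unit1 /= => ->; rewrite mulr1.
Qed.

(** The exponent of the additive group vanishes in [k], which yields a characteristic [p]; then the
    additive group is an elementary abelian [p]-group. *)
Lemma card_finField_pnat (k : finFieldType) : exists2 p, p \in [pchar k] & p.-nat #|k|.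
Proof.
pose e := exponent [set: k].
have : e%:R == 0 :> k.
  by rewrite -FinRing.zmodXgE expg_exponent // inE.
case/natf0_pchar => [|p pk]; first exact: exponent_gt0.
by exists p => //; rewrite -cardsT; exact: abelem_pgroup (fin_ring_pchar_abelem pk).
Qed.

Section Frobenius.
Variables (N : nat) (k : finFieldType) (e : nat).
Local Notation R := {mpoly k[N]}.
Local Notation Q := (#|k| ^ e)%N.

(** Since [Q] is a power of [#|k|], this is a ring endomorphism that fixes the constants, hence a
    [k]-linear one. *)
Definition frob (f : R) : R := f ^+ Q.

Lemma frob_is_zmod_morphism : zmod_morphism frob.
Proof.
have [p pk kp] := card_finField_pnat k.
have chR : p \in [pchar {mpoly k[N]}] by rewrite pchar_lalg.
have Qnat : ([pchar {mpoly k[N]}]).-nat Q.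
  by rewrite (eq_pnat _ (pcharf_eq chR)) pnatX kp.
have addf f g : frob (f + g) = frob f + frob g by exact: exprDn_pchar.
move=> f g; apply/eqP; rewrite eq_sym subr_eq -addf subrK.
by rewrite eqxx.
Qed.

Lemma frob_is_monoid_morphism : monoid_morphism frob.
Proof. by split; [rewrite /frob expr1n | move=> f g; rewrite /frob exprMn]. Qed.

HB.instance Definition _ := GRing.isZmodMorphism.Build R R frob frob_is_zmod_morphism.
HB.instance Definition _ := GRing.isMonoidMorphism.Build R R frob frob_is_monoid_morphism.

Lemma expf_cardX (c : k) : c ^+ Q = c.
Proof.
elim: (e) => [|d IH]; first by rewrite expr1.
by rewrite expnSr exprM IH expf_card_finField.
Qed.

Lemma frobZ c f : frob (c *: f) = c *: frob f.
Proof. by rewrite /frob exprZn expf_cardX. Qed.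

Lemma card_expn_gt0 : (0 < Q)%N.
Proof. by rewrite expn_gt0 (ltnW (card_finNzRing_gt1 k)). Qed.

Definition frob_residue (a : 'X_{1..N}) : {ffun 'I_N -> 'I_Q} :=
  [ffun i => Ordinal (ltn_pmod (a i) card_expn_gt0)].

Definition residue_mnm (r : {ffun 'I_N -> 'I_Q}) : 'X_{1..N} := [multinom (r i : nat) | i < N].

Definition frob_quot (a : 'X_{1..N}) : 'X_{1..N} := [multinom (a i %/ Q)%N | i < N].

Lemma frob_monomial (a : 'X_{1..N}) :
  'X_[a] = frob 'X_[frob_quot a] * 'X_[residue_mnm (frob_residue a)] :> R.
Proof.
rewrite /frob mpolyXn -mpolyXD; congr 'X_[_]; apply/mnmP => i.
by rewrite mnmDE mulmnE !mnmE ffunE /= -divn_eq.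
Qed.

Lemma mdeg_frob_quot (a : 'X_{1..N}) m : (mdeg a <= Q * m)%N -> (mdeg (frob_quot a) <= m)%N.
Proof.
move=> h; rewrite -(leq_pmul2l card_expn_gt0); apply: leq_trans h.
rewrite !mdegE big_distrr /=; apply: leq_sum => i _.
by rewrite mnmE mulnC leq_trunc_div.
Qed.

(** The monomials with all exponents below [Q] generate [k[x]] over its [Q]-th powers, by division
    with remainder of each exponent; this divides the degrees of the coefficients by [Q]. *)
Lemma frob_decomposition (f : R) m : (msize f <= (Q * m).+1)%N ->
  exists2 h : {ffun 'I_N -> 'I_Q} -> R, (forall r, (msize (h r) <= m.+1)%N) &
    f = \sum_r frob (h r) * 'X_[residue_mnm r].
Proof.
move=> szf.
exists (fun r => \sum_(a : 'X_{1..N < (Q * m).+1} | frob_residue a == r) f@_a *: 'X_[frob_quot a]).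
  move=> r; apply: msize_sum_leq => a _; apply: (leq_trans (msizeZ_le _ _)).
  by rewrite msizeX ltnS; apply: mdeg_frob_quot; rewrite -ltnS bmdeg.
rewrite {1}(mpolywE szf) (partition_big (fun a : 'X_{1..N < (Q * m).+1} => frob_residue a) xpredT) //.
apply: eq_bigr => r _; rewrite rmorph_sum mulr_suml; apply: eq_bigr => a /eqP ar.
by rewrite /= frobZ -scalerAl -ar -frob_monomial.
Qed.

End Frobenius.

(* Multiply by the adjugate of [1 - phi Z]. *)
Lemma semilinear_cramer (R : comNzRingType) (P : set R) (phi : {rmorphism R -> R}) n r
    (x : 'I_n -> R) (y : 'I_r -> R) (Z : 'M[R]_n) (C : 'M[R]_(n, r)) :
  is_ideal P ->
  (forall i, P (x i - (\sum_j phi (Z i j) * x j + \sum_j phi (C i j) * y j))) ->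
  exists C' : 'M[R]_(n, r),
    forall i, P (phi (\det (1%:M - Z)) * x i - \sum_j phi (C' i j) * y j).
Proof.
move=> Pid h; set A := 1%:M - Z; exists (\adj A *m C) => i.
pose X := \col_i x i; pose Y := \col_j y j.
pose D := map_mx phi A *m X - map_mx phi C *m Y.
have DE j : D j 0 = x j - (\sum_l phi (Z j l) * x l + \sum_l phi (C j l) * y l).
  rewrite /D map_mxB map_mx1 mulmxBl mul1mx !mxE opprD addrA.
  congr (_ - _ - _); apply: eq_bigr => l _; by rewrite !mxE.
have -> : phi (\det A) * x i - \sum_j phi ((\adj A *m C) i j) * y j
    = (map_mx phi (\adj A) *m D) i 0.
  rewrite /D mulmxBr !mulmxA -!map_mxM mul_adj_mx map_scalar_mx mul_scalar_mx !mxE.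
  by congr (_ - _); apply: eq_bigr => j _; rewrite !mxE.
rewrite mxE; apply: ideal_sum => // j _; apply: ideal_mull => //.
by rewrite DE.
Qed.

(** * Initial monomials at the origin *)

Section WeightedOrder.
Variables (N : nat) (w : 'I_N -> nat).
Hypothesis w_gt0 : forall i, (0 < w i)%N.

Definition mwt (a : 'X_{1..N}) : nat := \sum_i w i * a i.

(** Weight first, with ties broken by the monomial order, which makes the comparison total and
    compatible with products. *)
Definition ltw (a b : 'X_{1..N}) : bool :=
  (mwt a < mwt b)%N || ((mwt a == mwt b) && (a < b)%O).

Lemma mwtD a b : mwt (a + b)%MM = (mwt a + mwt b)%N.
Proof. by rewrite /mwt -big_split; apply: eq_bigr => i _; rewrite mnmDE mulnDr. Qed.

Lemma leq_mdeg_mwt a : (mdeg a <= mwt a)%N.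
Proof. by rewrite mdegE; apply: leq_sum => i _; rewrite leq_pmull. Qed.

Lemma mwt_eq0 a : (mwt a == 0%N) = (a == 0%MM).
Proof.
apply/eqP/eqP => [h|->].
  by apply/eqP; rewrite -mdeg_eq0 -leqn0 -h leq_mdeg_mwt.
by rewrite /mwt big1 // => i _; rewrite mnm0E muln0.
Qed.

Lemma ltw_irr a : ltw a a = false.
Proof. by rewrite /ltw ltnn ltxx andbF. Qed.

Lemma ltw_trans : transitive ltw.
Proof.
move=> b a c; rewrite /ltw => /orP[h1|/andP[/eqP h1 l1]] /orP[h2|/andP[/eqP h2 l2]].
- by rewrite (ltn_trans h1 h2).
- by rewrite -h2 h1.
- by rewrite h1 h2.
- by rewrite h1 h2 eqxx (lt_trans l1 l2) orbT.
Qed.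

Lemma ltw_total a b : a != b -> ltw a b || ltw b a.
Proof.
move=> ab; rewrite /ltw; case: ltngtP => //= _.
by rewrite -neq_lt.
Qed.

Lemma ltwD m a b : ltw (m + a)%MM (m + b)%MM = ltw a b.
Proof. by rewrite /ltw !mwtD ltn_add2l eqn_add2l ltmc_add2r. Qed.

Lemma mwt_le a b : ~~ ltw b a -> (mwt a <= mwt b)%N.
Proof. by rewrite /ltw negb_or => /andP[]; rewrite -leqNgt. Qed.

Lemma ltw_min (s : seq 'X_{1..N}) : s != [::] ->
  exists2 a, a \in s & {in s, forall b, ~~ ltw b a}.
Proof.
elim: s => // x s IH _; have [->|s0] := eqVneq s [::].
  by exists x; rewrite ?mem_head // => b; rewrite inE => /eqP ->; rewrite ltw_irr.
have [a as_ amin] := IH s0.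
have [xa|nxa] := boolP (ltw x a).
  exists x; first exact: mem_head.
  move=> b; rewrite inE => /predU1P[->|/amin nb]; first by rewrite ltw_irr.
  by apply: contraNN nb => bx; exact: ltw_trans xa.
exists a; first by rewrite inE as_ orbT.
by move=> b; rewrite inE => /predU1P[->|/amin].
Qed.

Variable k : fieldType.
Implicit Types (f g : {mpoly k[N]}) (P : set {mpoly k[N]}).

(** The least exponent is singled out, not the greatest: this is a local order, suited to the
    behaviour at the origin. *)
Definition is_initial f a : Prop := f@_a != 0 /\ forall b, f@_b != 0 -> ~~ ltw b a.

(** The local counterpart of [standard]: the monomials outside the initial ideal. *)
Definition cobasis P (a : 'X_{1..N}) : bool :=
  ~~ `[< exists2 f, P f & is_initial f a >].

Lemma initial_exists f : f != 0 -> exists a, is_initial f a.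
Proof.
rewrite -msupp_eq0 => /ltw_min [a af amin]; exists a.
by split; [rewrite -mcoeff_msupp | move=> b; rewrite -mcoeff_msupp; exact: amin].
Qed.

Lemma cobasis_le P a b : is_ideal P -> (a <= b)%MM -> cobasis P b -> cobasis P a.
Proof.
move=> Pid ab; apply: contraNN => /asboolP[f Pf [fa fmin]]; apply/asboolP.
exists (f * 'X_[b - a]); first exact: ideal_mulr.
have bE : ((b - a) + a)%MM = b by rewrite submK.
split; first by have := mcoeffMX f (b - a)%MM a; rewrite bE => ->.
move=> c; rewrite -mcoeff_msupp (perm_mem (msuppMX _ _)) => /mapP[d].
by rewrite mcoeff_msupp => /fmin nd ->; rewrite -{2}bE ltwD.
Qed.

(** Division from the lowest term upwards: an initial term that occurs in [P] is cancelled into [h],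
    any other goes into [g]. Such a division need not end for a local order, so it stops at weight
    [W] and leaves the rest in [r]. *)
Lemma local_reduction P f W : is_ideal P -> exists g h r : {mpoly k[N]},
  [/\ f = g + h + r, P h,
      forall a, g@_a != 0 -> cobasis P a /\ (mwt a < W)%N &
      forall a, r@_a != 0 -> (W <= mwt a)%N].
Proof.
move=> Pid.
(* The measure is the number of exponents of weight below [W] at or above some exponent of [f].
   Removing the initial term at [a] takes [a] out of this set and adds nothing. *)
pose mu f := #|[set b : 'X_{1..N < W} | (mwt b < W)%N && has (fun a => ~~ ltw b a) (msupp f)]|.
have [n] := ubnP (mu f); elim: n f => // n IH f; rewrite ltnS => muf.
have [->|f0] := eqVneq f 0.
  exists 0, 0, 0; split; rewrite ?addr0 //; first exact: ideal0.
    by move=> a; rewrite mcoeff0 eqxx.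
  by move=> a; rewrite mcoeff0 eqxx.
have [a [fa fmin]] := initial_exists f0.
have [Wa|aW] := leqP W (mwt a).
  exists 0, 0, f; split; rewrite ?add0r //; first exact: ideal0.
    by move=> b; rewrite mcoeff0 eqxx.
  by move=> b /fmin /mwt_le; exact: leq_trans.
have key u : is_initial u a -> u@_a = f@_a -> (mu (f - u)%R < n)%N.
  move=> [ua umin] e; apply: leq_trans muf; apply: proper_card.
  have ltf b : (f - u)@_b != 0 -> ltw a b.
    rewrite mcoeffB; have [->|ba] := eqVneq b a; first by rewrite e subrr eqxx.
    move=> h; have : f@_b != 0 \/ u@_b != 0.
      have [fb|] := eqVneq f@_b 0; last by left.
      by right; move: h; rewrite fb sub0r oppr_eq0.
    have := ltw_total ba.
    by case/orP => // ltb; case=> [/fmin|/umin]; rewrite ltb.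
  apply/properP; split.
    apply/fintype.subsetP => b; rewrite !inE => /andP[-> /= /hasP[c]].
    rewrite mcoeff_msupp => /ltf ac nbc; apply/hasP; exists a.
      by rewrite mcoeff_msupp.
    by apply: contraNN nbc => ba; exact: ltw_trans ac.
  have ab : (mdeg a < W)%N := leq_ltn_trans (leq_mdeg_mwt a) aW.
  exists (BMultinom ab); rewrite inE /= aW /=.
    by apply/hasP; exists a; rewrite ?mcoeff_msupp // ltw_irr.
  by apply/hasPn => b; rewrite mcoeff_msupp => /ltf ->.
have [/asboolP[u Pu [ua umin]]|ca] := boolP `[< exists2 u, P u & is_initial u a >].
  pose v := (f@_a / u@_a) *: u.
  have Pv : P v by exact: idealZ.
  have c0 : f@_a / u@_a != 0 by rewrite mulf_neq0 ?invr_neq0.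
  have iv : is_initial v a.
    split; first by rewrite mcoeffZ mulf_neq0.
    by move=> b; rewrite mcoeffZ mulf_eq0 negb_or => /andP[_ /umin].
  have [|g [h [r [e Ph hg hr]]]] := IH _ (key v iv _); first by rewrite mcoeffZ divfK.
  exists g, (h + v), r; split=> //; last exact: idealD.
  by rewrite -[LHS](subrK v) e (addrA g) (addrAC (g + h)).
pose v : {mpoly k[N]} := f@_a *: 'X_[a].
have vE b : v@_b = f@_a * (a == b)%:R by rewrite mcoeffZ mcoeffX.
have iv : is_initial v a.
  split; first by rewrite vE eqxx mulr1.
  move=> b; rewrite vE; have [<-|ab] := eqVneq a b; first by rewrite ltw_irr.
  by rewrite mulr0 eqxx.
have [|g [h [r [e Ph hg hr]]]] := IH _ (key v iv _); first by rewrite vE eqxx mulr1.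
exists (g + v), h, r; split=> //.
  by rewrite -[LHS](subrK v) e (addrAC g v) (addrAC (g + h)).
move=> b; have [gb|gb] := eqVneq g@_b 0; last by move=> _; exact: hg.
have [<-|ab] := eqVneq a b; first by move=> _; split.
by rewrite mcoeffD gb vE (negPf ab) mulr0 add0r eqxx.
Qed.

(** Exponents all below [Q] have weight at most [(\sum_i w i) * Q]; this is where the truncation
    weight used below comes from. *)
Lemma mwt_large (a : 'X_{1..N}) Q : ((\sum_i w i) * Q < mwt a)%N -> exists i, (Q <= a i)%N.
Proof.
move=> h; apply: contrapT => ni; move: h; apply/negP; rewrite -leqNgt.
rewrite big_distrl /=; apply: leq_sum => i _; rewrite leq_pmul2l //.
by rewrite ltnW // ltnNge; apply/negP => hi; apply: ni; exists i.
Qed.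

End WeightedOrder.

(** Each monomial of [r] is divisible by some ['X_i ^+ Q], so [r] lies in the ideal of the [Q]-th
    powers of the coordinates. *)
Lemma bracket_power_decomposition N (k : fieldType) Q (r : {mpoly k[N]}) :
  (forall a, r@_a != 0 -> exists i, (Q <= a i)%N) ->
  exists g : 'I_N -> {mpoly k[N]}, r = \sum_i 'X_i ^+ Q * g i.
Proof.
move=> hr; rewrite [r]mpolyE big_seq.
apply: (big_ind (fun r => exists g : 'I_N -> {mpoly k[N]}, r = \sum_i 'X_i ^+ Q * g i)).
- by exists (fun=> 0); rewrite big1 // => i _; rewrite mulr0.
- move=> _ _ [g ->] [g' ->]; exists (fun i => g i + g' i).
  by rewrite -big_split; apply: eq_bigr => i _; rewrite mulrDr.
move=> a; rewrite mcoeff_msupp => /hr [i Qa].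
exists (fun j => if j == i then r@_a *: 'X_[a - U_(i) *+ Q] else 0).
rewrite (bigD1 i) //= eqxx big1 => [|j ji]; last by rewrite (negPf ji) mulr0.
rewrite addr0 -scalerAr mpolyXn -mpolyXD addmC submK //.
apply/mnm_lepP => j; rewrite mulmnE mnm1E.
by case: eqP => [<-|_]; rewrite ?mul1n ?mul0n.
Qed.

(** * Rank of the quotient over its [Q]-th powers *)

Section FrobeniusRank.
Variables (N : nat) (k : finFieldType) (e : nat) (w : 'I_N -> nat).
Hypothesis w_gt0 : forall i, (0 < w i)%N.
Variable P : set {mpoly k[N]}.
Hypothesis Ppr : is_prime_ideal P.
Hypothesis P0 : forall f, P f -> f@_0%MM = 0.
Local Notation Q := (#|k| ^ e)%N.
Local Notation R := {mpoly k[N]}.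

Definition local_cobasis W : {set 'X_{1..N < W}} :=
  [set a : 'X_{1..N < W} | cobasis w P a && (mwt w a < W)%N].

Local Notation W := ((\sum_i w i) * Q).+1.
Local Notation J := #|{: {ffun 'I_N -> 'I_Q}}|.
Local Notation rk := #|local_cobasis W|.

Let Pid : is_ideal P. Proof. by case: Ppr. Qed.
(** [x] lists the monomials with exponents below [Q], which generate [k[x]] over its [Q]-th powers;
    [y] lists the monomials to which Nakayama's lemma reduces them. *)
Let x (i : 'I_J) : R := 'X_[residue_mnm (enum_val i)].
Let b (j : 'I_rk) : 'X_{1..N} := bmnm (enum_val j).
Let y (j : 'I_rk) : R := 'X_[b j].

(** Local reduction leaves a remainder in the ideal of the ['X_l ^+ Q]. Expanded in the [x j], it
    has as coefficients the [Q]-th powers of polynomials without constant term, which is the input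
    of Nakayama's lemma. *)
Lemma frob_generation (i : 'I_J) : exists zc : ('I_J -> R) * ('I_rk -> R),
  (forall j, (zc.1 j)@_0%MM = 0) /\
  P (x i - (\sum_j frob e (zc.1 j) * x j + \sum_j frob e (zc.2 j) * y j)).
Proof.
have [g [h [t [E Ph hg ht]]]] := local_reduction w_gt0 (x i) W Pid.
have [G hG] : exists g : 'I_N -> {mpoly k[N]}, t = \sum_i 'X_i ^+ Q * g i.
  by apply: bracket_power_decomposition => a /ht; exact: mwt_large.
have dec l : exists H : {ffun 'I_N -> 'I_Q} -> R,
    G l = \sum_s frob e (H s) * 'X_[residue_mnm s].
  have [|H _ ->] := @frob_decomposition _ _ e (G l) (msize (G l)); last by exists H.
  by rewrite ltnW // ltnS leq_pmull // card_expn_gt0.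
have [H hH] := choice dec.
(* The factor ['X_l] kills the constant terms of the first family. The second consists of constants,
   which equal their own [Q]-th powers. *)
exists (fun j => \sum_l 'X_l * H l (enum_val j), fun j => (g@_(b j))%:MP); split => /=.
  move=> j; rewrite mcoeff0_meval raddf_sum big1 // => l _.
  by rewrite /= mevalM mevalXU mul0r.
have -> : \sum_j frob e (\sum_l 'X_l * H l (enum_val j)) * x j = t.
  rewrite hG (eq_bigr (fun l => \sum_s 'X_l ^+ Q * (frob e (H l s) * 'X_[residue_mnm s])));
    last by move=> l _; rewrite hH mulr_sumr.
  rewrite exchange_big [RHS](reindex _ (onW_bij _ (enum_val_bij _))) /=.
  apply: eq_bigr => j _; rewrite rmorph_sum mulr_suml; apply: eq_bigr => l _.
  by rewrite /= /frob exprMn -mulrA.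
have -> : \sum_j frob e (g@_(b j))%:MP * y j = g.
  have szg : (msize g <= W)%N.
    rewrite msizeE; apply/bigmax_leqP_seq => a; rewrite mcoeff_msupp => /hg [_ aW] _.
    exact: leq_ltn_trans (leq_mdeg_mwt w_gt0 a) aW.
  rewrite [RHS](mpolywE szg) [RHS](bigID (mem (local_cobasis W))) /=.
  rewrite [X in _ = _ + X]big1 ?addr0; last first.
    move=> a; rewrite inE negb_and => na; apply/eqP; rewrite scaler_eq0.
    apply/orP; left; apply/negPn/negP => /hg [h1 h2].
    by rewrite h1 h2 in na.
  rewrite [RHS]big_enum_val /=.
  apply: eq_bigr => j _; rewrite -mul_mpolyC; congr (_ * _).
  by rewrite /frob -rmorphXn expf_cardX.
by rewrite E opprD addrA addrK addrAC subrr add0r.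
Qed.

(** The determinant form of Nakayama's lemma: [u] is [\det (1%:M - Z)], whose constant term is 1
    because [Z] vanishes at the origin, whereas all elements of [P] vanish there. *)
Lemma frob_cramer : exists u (C : 'M[R]_(J, rk)), ~ P u /\
  forall i, P (frob e u * x i - \sum_j frob e (C i j) * y j).
Proof.
have [zc hzc] := choice frob_generation.
pose Z := \matrix_(i < J, j < J) (zc i).1 j.
pose C := \matrix_(i < J, j < rk) (zc i).2 j.
have hP i : P (x i - (\sum_j frob e (Z i j) * x j + \sum_j frob e (C i j) * y j)).
  have -> : \sum_j frob e (Z i j) * x j = \sum_j frob e ((zc i).1 j) * x j.
    by apply: eq_bigr => j _; rewrite mxE.
  have -> : \sum_j frob e (C i j) * y j = \sum_j frob e ((zc i).2 j) * y j.
    by apply: eq_bigr => j _; rewrite mxE.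
  by have [] := hzc i.
have [C' hC'] := semilinear_cramer Pid hP.
exists (\det (1%:M - Z)), C'; split=> // /P0.
have -> : (\det (1%:M - Z))@_0%MM = \det (map_mx (mcoeff 0%MM) (1%:M - Z)).
  by rewrite det_map_mx.
have -> : map_mx (mcoeff 0%MM) (1%:M - Z) = 1%:M.
  apply/matrixP => i j; rewrite !mxE mcoeffB; have [-> _] := hzc i.
  by rewrite subr0 mcoeffMn mcoeff1 eqxx.
by move/eqP; rewrite det1 oner_eq0.
Qed.

(* After inverting [u], the [rk] monomials outside the initial ideal generate [k[x]/P]
   over its [Q]-th powers; the coefficients of [f] then have degree about [deg f / Q]. *)
Lemma frob_rank : exists c, forall m,
  (hilb P (Q * m).+1 <= rk * hilb P (m + c).+1)%N.
Proof.
have [u [C [Pu hC]]] := frob_cramer.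
have [_ _ PM] := Ppr.
pose c := (\max_(i < J) \max_(j < rk) msize (C i j))%N.
have Cc i j : (msize (C i j) <= c.+1)%N.
  by apply: leqW; rewrite /c (bigD1 i) //= (bigD1 j) //= -maxnA leq_max leqnn.
exists c => m.
pose X := {ffun std_mon P (Q * m).+1 -> k}.
have dec (v : X) : exists h : {ffun 'I_N -> 'I_Q} -> R, (forall s, (msize (h s) <= m.+1)%N) /\
    of_coords v = \sum_s frob e (h s) * 'X_[residue_mnm s].
  by have [h h1 h2] := frob_decomposition (msize_of_coords v); exists h.
have [h hh] := choice dec.
pose Y (v : X) (j : 'I_rk) := \sum_i h v (enum_val i) * C i j.
have szY v j : (msize (Y v j) <= (m + c).+1)%N.
  by apply: msize_sum_leq => i _; apply: msizeM_leq => //; have [] := hh v.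
have PY v : P (frob e u * of_coords v - \sum_j frob e (Y v j) * y j).
  have [_ ->] := hh v.
  rewrite [X in frob e u * X](reindex _ (onW_bij _ (enum_val_bij _))) /= mulr_sumr.
  have -> : \sum_j frob e (Y v j) * y j
      = \sum_(i < J) frob e (h v (enum_val i)) * \sum_j frob e (C i j) * y j.
    rewrite [RHS](eq_bigr (fun i => \sum_j frob e (h v (enum_val i)) * (frob e (C i j) * y j)));
      last by move=> i _; rewrite mulr_sumr.
    rewrite exchange_big; apply: eq_bigr => j _ /=.
    rewrite /Y raddf_sum mulr_suml; apply: eq_bigr => i _.
    by rewrite /= /frob exprMn -mulrA.
  rewrite -sumrB; apply: ideal_sum => // i _.
  by rewrite mulrCA -mulrBr; apply: (ideal_mull Pid); exact: hC.
rewrite -(leq_exp2l _ _ (card_finNzRing_gt1 k)) [X in (_ <= _ ^ X)%N]mulnC expnM -!card_coords.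
rewrite -[X in (_ <= _ ^ X)%N]card_ord -card_ffun.
(* The classes of the [Y v j] determine [v]: if they agree, [frob e u] times the difference of the
   two polynomials is in [P], and [u] is not. *)
apply: (leq_card (fun v : X => [ffun j : 'I_rk => nf_coords P (m + c).+1 (Y v j)])).
move=> v v' /ffunP evv'.
have Pj j : P (Y v j - Y v' j).
  by have := evv' j; rewrite !ffunE; apply: nf_coords_eq.
apply: (of_coords_inj (P := P)).
have : P (frob e u * (of_coords v - of_coords v')).
  have h1 := idealB Pid (PY v) (PY v').
  have h2 : P (\sum_j frob e (Y v j) * y j - \sum_j frob e (Y v' j) * y j).
    rewrite -sumrB; apply: ideal_sum => // j _; rewrite -mulrBl; apply: (ideal_mulr Pid).
    rewrite -raddfB -[X in P X]/(frob e (Y v j - Y v' j)) /frob -(prednK (card_expn_gt0 k e)) exprS.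
    exact: ideal_mulr.
  by have := idealD Pid h1 h2; rewrite addrAC subrKA opprB subrKA -mulrBr.
by case/PM => // /(prime_idealX Ppr).
Qed.

End FrobeniusRank.

(** * Coordinate subspaces in exponent sets of large growth *)

Lemma card_bounded_ffun (I T : finType) (A : I -> {set T}) :
  #|[set g : {ffun I -> T} | [forall i, g i \in A i]]| = (\prod_i #|A i|)%N.
Proof.
transitivity #|family A|.
  by apply: eq_card => g; rewrite inE; apply/forallP/familyP.
by rewrite card_family foldrE big_map big_enum.
Qed.

Lemma exists_subset_card (T : finType) (A : {set T}) n :
  (n <= #|A|)%N -> exists2 B : {set T}, B \subset A & #|B| = n.
Proof.
move=> nA; exists [set x in take n (enum A)].
  by apply/fintype.subsetP => x; rewrite inE => /mem_take; rewrite mem_enum.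
by rewrite cardsE (card_uniqP _) ?take_uniq ?enum_uniq // size_takel // -cardE.
Qed.

Lemma leq_mnm_mdeg N (a : 'X_{1..N}) i : (a i <= mdeg a)%N.
Proof. by rewrite mdegE (bigD1 i) //= leq_addr. Qed.

Lemma card_ord_lt L b : (b <= L)%N -> #|[set x : 'I_L | (x < b)%N]| = b.
Proof.
move=> bL; have winj : injective (widen_ord bL).
  by move=> x y /(congr1 val) /= xy; apply: val_inj.
rewrite -[RHS]card_ord -(card_imset _ winj).
apply: eq_card => x; rewrite inE; apply/idP/imsetP => [xb|[y _ ->]]; last exact: (valP y).
by exists (Ordinal xb) => //; apply: val_inj.
Qed.

Definition supported_in N (T : {set 'I_N}) (a : 'X_{1..N}) : bool :=
  [forall i, (i \notin T) ==> (a i == 0%N)].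

Lemma supported_inP N (T : {set 'I_N}) (a : 'X_{1..N}) :
  reflect (forall i, i \notin T -> a i = 0%N) (supported_in T a).
Proof.
apply: (iffP forallP) => h i; last by apply/implyP => /h ->.
by move=> iT; apply/eqP; move/implyP: (h i); apply.
Qed.

Section CoordinateSubspace.
Variables (N : nat) (w : 'I_N -> nat) (q n : nat) (D : 'X_{1..N} -> bool).
Hypothesis q_gt1 : (1 < q)%N.
Hypothesis D_le : forall a b, (a <= b)%MM -> D b -> D a.

Local Notation W e := ((\sum_i w i) * q ^ e).+1.
Local Notation region e := [set a : 'X_{1..N < W e} | D a && (mwt w a < W e)%N].

Hypothesis D_growth : forall e, ((q ^ e) ^ n <= #|region e|)%N.

(** Exponents are sorted by the set [U] of their coordinates that are at least [M]. Each of the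
    [2 ^ N] classes lies in a box with fewer than [n] sides of length [W e] and the others of length
    [M]. *)
Lemma region_card_le M e : (0 < M)%N ->
  (forall a, D a -> (#|[set i | (M <= a i)%N]| < n)%N) ->
  (#|region e| <= 2 ^ N * (M ^ N * W e ^ n.-1))%N.
Proof.
move=> M0 few; set L := (M + W e)%N.
pose big (a : 'X_{1..N < W e}) : {set 'I_N} := [set i | (M <= a i)%N].
have -> : (2 ^ N = #|{set 'I_N}|)%N by rewrite -cardsT -powersetT card_powerset cardsT card_ord.
rewrite -sum1_card (partition_big big xpredT) //= -sum_nat_const.
apply: leq_sum => U _; rewrite sum1dep_card.
have [Un|nU] := ltnP #|U| n; last first.
  rewrite (_ : [set _ | _] = finset.set0) ?cards0 //.
  apply/finset.setP => a; rewrite !inE; apply/negP => /andP[/andP[/few h _] /eqP aU].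
  by move: h; rewrite -/(big a) aU ltnNge nU.
pose A (i : 'I_N) : {set 'I_L} := [set x : 'I_L | (x < if i \in U then W e else M)%N].
have Lpos : (0 < L)%N by rewrite addn_gt0 M0.
pose F (a : 'X_{1..N < W e}) : {ffun 'I_N -> 'I_L} := [ffun i => insubd (Ordinal Lpos) (a i)].
have aL (a : 'X_{1..N < W e}) i : (a i < W e)%N.
  apply: leq_ltn_trans (bmdeg a); exact: leq_mnm_mdeg.
have FE (a : 'X_{1..N < W e}) i : F a i = a i :> nat.
  by rewrite ffunE val_insubd; have := aL a i; rewrite /L; case: ifP => //; lia.
have Finj : injective F.
  move=> a b /ffunP ab; apply/val_inj/mnmP => i.
  by rewrite /= -!FE ab.
rewrite -(card_imset _ Finj); apply: (@leq_trans (\prod_i #|A i|)%N).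
  rewrite -card_bounded_ffun; apply: subset_leq_card.
  apply/fintype.subsetP => g /imsetP[a]; rewrite !inE => /andP[_ /eqP aU] ->.
  apply/forallP => i; rewrite inE FE -aU inE.
  by case: ifP => [_|]; [exact: aL | rewrite ltnNge => ->].
have AE i : #|A i| = (if i \in U then W e else M)%N.
  by rewrite /A; case: ifP => _; rewrite card_ord_lt // /L ?leq_addl ?leq_addr.
rewrite (eq_bigr _ (fun i _ => AE i)) (bigID (mem U)) /= mulnC leq_mul //.
  rewrite (eq_bigr (fun=> M)); last by move=> i /negPf ->.
  rewrite prod_nat_const leq_pexp2l // -[X in (_ <= X)%N]card_ord; exact: max_card.
rewrite (eq_bigr (fun=> W e)); last by move=> i ->.
by rewrite prod_nat_const leq_pexp2l //; case: (n) Un.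
Qed.

(** Otherwise each [T] of size [n] supports an exponent [f T] outside [D]. With [M] above all
    entries of these, an exponent of [D] with [n] entries at least [M] would be a multiple of some
    [f T]; so [D] grows too slowly. *)
Lemma coordinate_subspace :
  exists2 T : {set 'I_N}, #|T| = n & forall a, supported_in T a -> D a.
Proof.
apply: contrapT => noT.
have ex (T : {set 'I_N}) : exists a, #|T| = n -> supported_in T a /\ ~~ D a.
  have [Tn|nTn] := pselect (#|T| = n); last by exists 0%MM => /nTn.
  apply: contrapT => na; apply: noT; exists T => // a aT.
  by apply/negPn/negP => Da; apply: na; exists a.
have [f hf] := choice ex.
pose M := (\max_T \max_i f T i).+1.
have fM T i : (f T i < M)%N.
  by rewrite ltnS (leq_trans _ (leq_bigmax T)) // (leq_trans _ (leq_bigmax i)).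
have few a : D a -> (#|[set i | (M <= a i)%N]| < n)%N.
  move=> Da; rewrite ltnNge; apply/negP => /exists_subset_card [T Tsub Tn].
  have [/supported_inP fT /negP] := hf T Tn; apply; apply: D_le Da.
  apply/mnm_lepP => i; have [iT|/fT -> //] := boolP (i \in T).
  move/fintype.subsetP/(_ i iT): Tsub; rewrite inE; apply: leq_trans.
  exact/ltnW/fM.
have n0 : (0 < n)%N.
  have : (0 < #|region 0|)%N by apply: leq_trans (D_growth 0); rewrite expn0 exp1n.
  case/card_gt0P => a; rewrite inE => /andP[/few h _].
  exact: leq_ltn_trans h.
(* As [W e] is at most [(\sum_i w i).+1 * q ^ e], the constant [C] absorbs all of the bound except
   [(q ^ e) ^ n.-1]. *)
pose C := (2 ^ N * (M ^ N * (\sum_i w i).+1 ^ n.-1))%N.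
have qC e : (q ^ e <= C)%N.
  have qe0 : (0 < q ^ e)%N by rewrite expn_gt0 ltnW.
  rewrite -(leq_pmul2r (m := (q ^ e) ^ n.-1)); last by rewrite expn_gt0 qe0.
  rewrite -expnS prednK //; apply: leq_trans (D_growth e) _.
  apply: leq_trans (region_card_le e (ltn0Sn _) few) _.
  rewrite /C -!mulnA !leq_mul2l -expnMn; do 2 (apply/orP; right).
  case: (n.-1) => [|j]; rewrite ?expn0 // leq_exp2r // mulSn -addn1 addnC.
  by rewrite leq_add2r.
(* The exponent [e = C] already gives a contradiction, since [C < q ^ C]. *)
by have := qC C; rewrite leqNgt ltn_expl.
Qed.

End CoordinateSubspace.

Lemma size_scale_argument (H : {poly rat}) (c : rat) : c != 0 ->
  size (H \Po (c *: 'X)) = size H.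
Proof. by move=> c0; rewrite size_comp_poly2 // size_scale // size_polyX. Qed.

Lemma lead_coef_scale_argument (H : {poly rat}) (c : rat) : c != 0 ->
  lead_coef (H \Po (c *: 'X)) = lead_coef H * c ^+ (size H).-1.
Proof.
by move=> c0; rewrite lead_coef_comp ?size_scale ?size_polyX // lead_coefZ lead_coefX mulr1.
Qed.

Lemma lead_coef_shift (H : {poly rat}) (c : rat) : lead_coef (H \Po ('X + c%:P)) = lead_coef H.
Proof. by rewrite lead_coef_comp ?size_XaddC // lead_coefXaddC expr1n mulr1. Qed.

Lemma size_shift (H : {poly rat}) (c : rat) : size (H \Po ('X + c%:P)) = size H.
Proof. by rewrite size_comp_poly2 // size_XaddC. Qed.

(** The exponent 0 is least for [ltw], and adding [a] preserves the order. *)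
Lemma mcoeff_mulX_initial N (k : fieldType) (w : 'I_N -> nat) (a b : 'X_{1..N})
    (V : {mpoly k[N]}) : (forall i, (0 < w i)%N) ->
  ('X_[a] * V)@_b != 0 -> ~~ ltw w b a.
Proof.
move=> w0; rewrite -mcoeff_msupp mulrC (perm_mem (msuppMX _ _)) => /mapP[m _ ->].
rewrite -[X in ltw _ _ X]addm0 ltwD /ltw ltx0 andbF orbF -leqNgt.
by rewrite [X in (X <= _)%N](_ : _ = 0%N) //; apply/eqP; rewrite mwt_eq0.
Qed.

(** * Local dimension at the origin *)

Section LocalDimension.
Variables (N n : nat) (k : finFieldType) (w : 'I_N -> nat) (P : set {mpoly k[N]}).
Variable H : {poly rat}.
Hypothesis w_gt0 : forall i, (0 < w i)%N.
Hypothesis Ppr : is_prime_ideal P.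
Hypothesis P0 : forall f, P f -> f@_0%MM = 0.
Hypothesis hH : is_hilbert_poly P H.
Hypothesis szH : size H = n.+1.

(** Both sides of [frob_rank] are polynomials in [m] of degree [n] for large [m], with leading
    coefficients [Q ^ n] and [r] times that of [H]. *)
Lemma local_cobasis_growth e :
  ((#|k| ^ e) ^ n <= #|local_cobasis w P ((\sum_i w i) * #|k| ^ e).+1|)%N.
Proof.
set r := #|_|; have [Pid P1 _] := Ppr.
have lH : 0 < lead_coef H := hilbert_poly_lead_gt0 Pid P1 hH.
have Q0 := card_expn_gt0 k e; set Q := (#|k| ^ e)%N in Q0 *.
have Q0R : Q%:R != 0 :> rat by rewrite pnatr_eq0 -lt0n.
have [c hc] := frob_rank e w_gt0 Ppr P0.
have ev : eventually (fun m => (H \Po (Q%:R *: 'X)).[m%:R]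
    <= (r%:R *: (H \Po ('X + c%:R%:P))).[m%:R]).
  have e1 : eventually (fun m => H.[(Q * m)%:R] = (hilb P (Q * m).+1)%:R).
    by apply: (eventually_comp (f := muln Q) _ hH) => m; rewrite leq_pmull.
  have e2 : eventually (fun m => H.[(m + c)%:R] = (hilb P (m + c).+1)%:R).
    by apply: (eventually_comp (f := addn^~ c) _ hH) => m; rewrite leq_addr.
  apply: eventually_imp (eventually_and e1 e2) => m [h1 h2].
  rewrite hornerZ !horner_comp !hornerE -natrM -natrD h1 h2 -natrM ler_nat.
  exact: hc.
(* If [r] were 0, the right side would be the zero polynomial, while the left side has positive
   leading coefficient. *)
have r0 : r != 0%N.
  apply/eqP => r0; have := size_le_eventually _ ev.
  rewrite r0 scale0r size_poly0 size_scale_argument // szH lead_coef_scale_argument //.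
  by move=> h; have := h (mulr_gt0 lH (exprn_gt0 _ _)); rewrite ltr0n Q0 => /(_ isT).
have rR : r%:R != 0 :> rat by rewrite pnatr_eq0.
have := lead_coef_le_eventually _ ev.
rewrite size_scale // size_shift size_scale_argument // lead_coef_scale_argument //.
rewrite lead_coefZ lead_coef_shift mulrC ler_pM2r // szH /= -natrX ler_nat.
exact.
Qed.

Lemma coordinate_cobasis :
  exists2 T : {set 'I_N}, #|T| = n & forall a, supported_in T a -> cobasis w P a.
Proof.
have [Pid _ _] := Ppr.
apply: (coordinate_subspace (card_finNzRing_gt1 k)).
  by move=> a b; exact: cobasis_le.
exact: local_cobasis_growth.
Qed.

End LocalDimension.

(** * Lattice points of weighted simplices *)

Section CountSimplex.
Variables (N : nat) (w : 'I_N -> nat) (T : {set 'I_N}).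
Hypothesis w_gt0 : forall i, (0 < w i)%N.

Definition weighted_simplex W : {set 'X_{1..N < W}} :=
  [set a : 'X_{1..N < W} | supported_in T a && (mwt w a < W)%N].

(** Dividing each coordinate by [w i] sends an exponent of degree at most [m] on [T] to a point of
    the weighted simplex and a remainder with [\prod_(i in T) w i] possible values. The source has
    at least [m.+1 ^ #|T| / #|T|!] elements. *)
Lemma weighted_simplex_card m :
  (m.+1 ^ #|T| <= (#|T|)`! * (#|weighted_simplex m.+1| * \prod_(i in T) w i))%N.
Proof.
apply: (@leq_trans ((#|T|)`! * #|{: 'X_{1..#|T| < m.+1}}|)%N).
  rewrite card_bmultinom mulnC bin_ffact ffact_prod.
  rewrite -[X in (_ ^ X)%N]card_ord -prod_nat_const; apply: leq_prod => i _.
  by have := ltn_ord i; lia.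
rewrite leq_mul2l; apply/orP; right.
(* [ext] moves an exponent indexed by the enumeration of [T] to the coordinates in [T], with zeros
   elsewhere. *)
pose ext (a : 'X_{1..#|T|}) : 'X_{1..N} :=
  [multinom (\sum_(j | enum_val j == i) a j)%N | i < N].
have extE a j : ext a (enum_val j) = a j.
  rewrite mnmE (big_pred1 j) // => l.
  by apply/eqP/eqP => [/enum_val_inj|->].
have ext0 a i : i \notin T -> ext a i = 0%N.
  move=> iT; rewrite mnmE big1 // => j /eqP ji.
  by move: iT; rewrite -ji enum_valP.
have mdeg_ext a : mdeg (ext a) = mdeg a.
  rewrite !mdegE (eq_bigr (fun i => \sum_(j | enum_val j == i) a j)%N) => [|i _]; last by rewrite mnmE.
  rewrite (exchange_big_dep xpredT) //=; apply: eq_bigr => j _.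
  by rewrite (big_pred1 (enum_val j)) // => i; rewrite eq_sym.
set L := (\sum_i w i).+1.
have wL i : (w i < L)%N by rewrite ltnS (bigD1 i) //= leq_addr.
pose quot (a : 'X_{1..#|T|}) : 'X_{1..N} := [multinom (ext a i %/ w i)%N | i < N].
have mwt_quot a : (mwt w (quot a) <= mdeg a)%N.
  rewrite -mdeg_ext mdegE; apply: leq_sum => i _.
  by rewrite mnmE mulnC leq_trunc_div.
have quot_bound (a : 'X_{1..#|T| < m.+1}) : (mdeg (quot a) < m.+1)%N.
  exact: leq_ltn_trans (leq_mdeg_mwt w_gt0 _) (leq_ltn_trans (mwt_quot a) (bmdeg a)).
pose rem (a : 'X_{1..#|T|}) : {ffun 'I_N -> 'I_L} :=
  [ffun i => inord (ext a i %% w i)].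
have remE a i : rem a i = (ext a i %% w i)%N :> nat.
  by rewrite ffunE inordK // ltnS ltnW // (leq_trans (ltn_pmod _ (w_gt0 i))) // -ltnS.
pose F (a : 'X_{1..#|T| < m.+1}) := (BMultinom (quot_bound a), rem a).
have Finj : injective F.
  move=> a b ab; have /mnmP q : quot a = quot b by have := congr1 (fun x => bmnm x.1) ab.
  have r : rem a = rem b by have := congr1 snd ab.
  apply/val_inj/mnmP => j /=; rewrite -(extE a j) -(extE b j).
  have := q (enum_val j); rewrite !(mnmE (fun i => (ext _ i %/ w i)%N)) => qj.
  by rewrite (divn_eq (ext a (enum_val j)) (w (enum_val j))) qj -remE r remE -divn_eq.
(* Outside [T] the bound 1 leaves only the remainder 0, so these coordinates contribute a factor
   1. *)
pose A (i : 'I_N) : {set 'I_L} := [set x : 'I_L | (x < if i \in T then w i else 1)%N].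
have prodA : (\prod_(i in T) w i = \prod_i #|A i|)%N.
  rewrite [RHS](bigID (mem T)) /= [X in _ = (_ * X)%N]big1 ?muln1 => [|i /negPf iT].
    apply: eq_bigr => i iT; by rewrite /A iT card_ord_lt // ltnW.
  by rewrite /A iT card_ord_lt.
rewrite prodA -card_bounded_ffun -cardsX -cardsT -(card_imset _ Finj).
apply: subset_leq_card; apply/fintype.subsetP => p /imsetP[a _ ->].
rewrite !inE /=; apply/andP; split.
  apply/andP; split; last exact: leq_ltn_trans (mwt_quot a) (bmdeg a).
  by apply/supported_inP => i iT; rewrite mnmE ext0 // div0n.
apply/forallP => i; rewrite inE remE; case: ifPn => [_|/ext0 ->]; first by rewrite ltn_pmod.
by rewrite mod0n.
Qed.

End CountSimplex.

(** * Points of a box *)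

Section PointBound.
Variables (N n : nat) (k : finFieldType) (B : 'I_N -> {set k}) (P : set {mpoly k[N]}).
Variables (S : {set {ffun 'I_N -> k}}).
Hypothesis B_gt0 : forall i, (0 < #|B i|)%N.
Hypothesis Ppr : is_prime_ideal P.
Hypothesis SB : S \subset box B.
Hypothesis SP : forall s f, s \in S -> P f -> f.@[s] = 0.
Local Notation R := {mpoly k[N]}.
Local Notation w := (fun i : 'I_N => #|B i|).

(* It vanishes to weighted order at least [mwt a] at every point of the box, with
   equality only at [s]. *)
Definition box_basis (s : {ffun 'I_N -> k}) (a : 'X_{1..N}) : R :=
  (\prod_i (\prod_(b in B i) ('X_i - b%:MP)) ^+ a i) *
  \prod_i \prod_(b in B i | b != s i) ('X_i - b%:MP).

Lemma msize_XsubC (i : 'I_N) (b : k) : (msize ('X_i - b%:MP : R) <= 2)%N.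
Proof.
apply: msizeB_leq; first by rewrite msizeX mdeg1.
by rewrite msizeC; case: (_ != _).
Qed.

Lemma msize_box_basis s a : (msize (box_basis s a) <= (mwt w a + \sum_i #|B i|).+1)%N.
Proof.
apply: msizeM_leq.
  apply: msize_prod_leq => i _; rewrite mulnC; apply: msize_exp_leq.
  rewrite -sum1_card; apply: msize_prod_leq => b _; exact: msize_XsubC.
apply: msize_prod_leq => i _; apply: leq_trans (msize_prod_leq (d := fun=> 1%N) _ _) _.
  by move=> b _; exact: msize_XsubC.
rewrite ltnS -sum1_card [X in (_ <= X)%N](bigID (fun b => b != s i)) /=; exact: leq_addr.
Qed.

(** After translation to [s0], each [\prod_(b in B i) ('X_i - b%:MP)] is ['X_i] times a factor that
    is nonzero at the origin, and the Lagrange factor of [s] is nonzero there only when [s = s0]. *)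
Lemma translate_box_basis (s0 s : {ffun 'I_N -> k}) a : s0 \in box B -> s \in box B ->
  exists2 V : R, translate s0 (box_basis s a) = 'X_[a] * V & (V@_0%MM == 0) = (s != s0).
Proof.
rewrite !inE => /forallP s0B /forallP sB.
pose v i : R := \prod_(b in B i | b != s0 i) ('X_i + (s0 i - b)%:MP).
pose l : R := \prod_i \prod_(b in B i | b != s i) ('X_i + (s0 i - b)%:MP).
have tX i b : translate s0 ('X_i - b%:MP) = 'X_i + (s0 i - b)%:MP.
  by rewrite rmorphB /= translateXU translateC mpolyCB addrA.
exists ((\prod_i v i ^+ a i) * l).
  rewrite rmorphM !rmorph_prod mulrA; congr (_ * _).
    rewrite mpolyXE_id -big_split; apply: eq_bigr => i _.
    rewrite rmorphXn rmorph_prod /= -exprMn (bigD1 (s0 i)) //=; congr ((_ * _) ^+ _).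
      by rewrite tX subrr addr0.
    by apply: eq_bigr => b _; exact: tX.
  by apply: eq_bigr => i _; rewrite rmorph_prod; apply: eq_bigr => b _; exact: tX.
have vE i : (v i).@[fun=> 0] != 0.
  rewrite rmorph_prod; apply/prodf_neq0 => b /andP[_ bs].
  by rewrite /= mevalD mevalXU mevalC add0r subr_eq0 eq_sym.
have lE : l.@[fun=> 0] = \prod_i \prod_(b in B i | b != s i) (s0 i - b).
  rewrite rmorph_prod; apply: eq_bigr => i _; rewrite /= rmorph_prod.
  by apply: eq_bigr => b _; rewrite /= mevalD mevalXU mevalC add0r.
have pE : (\prod_i v i ^+ a i).@[fun=> 0] != 0.
  by rewrite rmorph_prod; apply/prodf_neq0 => i _; rewrite rmorphXn; apply: expf_neq0; exact: vE.
rewrite mcoeff0_meval mevalM mulf_eq0 (negPf pE) /= lE.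
apply/prodf_eq0/idP => [[i _ /prodf_eq0 [b /andP[_ bs]]]|].
  by rewrite subr_eq0 => /eqP sb; apply: contraNneq bs => ss; rewrite -sb ss.
apply: contraNP => nz; apply/eqP/ffunP => i; apply/eqP/negPn/negP => si.
apply: nz; exists i => //; apply/prodf_eq0; exists (s0 i); last by rewrite subrr.
by rewrite s0B eq_sym.
Qed.

Section Independence.
Variable T : {ffun 'I_N -> k} -> {set 'I_N}.
Hypothesis hT : forall s a, s \in S -> supported_in (T s) a ->
  cobasis w (translate_ideal s P) a.
Variable W : nat.

Definition box_index : {set {ffun 'I_N -> k} * 'X_{1..N < W}} :=
  [set p : {ffun 'I_N -> k} * 'X_{1..N < W} | (p.1 \in S) && (p.2 \in weighted_simplex w (T p.1) W)].

(** Among the indices with nonzero coefficient, one with least exponent is chosen and its point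
    moved to the origin. That exponent is then initial in an element of the translated ideal,
    against [hT]. *)
Lemma box_basis_independent (d : {ffun 'I_N -> k} * 'X_{1..N < W} -> k) :
  P (\sum_(p in box_index) d p *: box_basis p.1 p.2) ->
  forall p, p \in box_index -> d p = 0.
Proof.
move=> Pd p1 p1I; apply/eqP/negPn/negP => dp1.
pose D := [set p in box_index | d p != 0].
have [_ /mapP[p0 p0D ->] p0min] : exists2 a, a \in [seq bmnm p.2 | p <- enum D] &
    {in [seq bmnm p.2 | p <- enum D], forall b, ~~ ltw w b a}.
  apply: ltw_min; rewrite -size_eq0 size_map -cardE cards_eq0.
  by apply/finset.set0Pn; exists p1; rewrite inE p1I.
rewrite mem_enum inE in p0D; case/andP: p0D => p0I dp0.
have pmin p : p \in box_index -> d p != 0 -> ~~ ltw w p.2 p0.2.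
  by move=> pI dp; apply: p0min; apply: map_f; rewrite mem_enum inE pI.
have SB' s : s \in S -> s \in box B by move/fintype.subsetP: SB; apply.
have inS p : p \in box_index -> p.1 \in S by rewrite inE => /andP[].
have [s0S a0T] : p0.1 \in S /\ supported_in (T p0.1) p0.2.
  by move: p0I; rewrite !inE => /andP[-> /andP[-> _]].
have /negP := hT s0S a0T; apply; apply/asboolP.
pose h := translate p0.1 (\sum_(p in box_index) d p *: box_basis p.1 p.2).
exists h; first by apply/translate_idealP.
have hE b : h@_b = \sum_(p in box_index) d p * (translate p0.1 (box_basis p.1 p.2))@_b.
  rewrite /h translate_sum raddf_sum; apply: eq_bigr => p _ /=.
  by rewrite translateZ mcoeffZ.
have tb p b : p \in box_index -> (translate p0.1 (box_basis p.1 p.2))@_b != 0 -> ~~ ltw w b p.2.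
  move=> pI; have [V -> _] := translate_box_basis p.2 (SB' _ s0S) (SB' _ (inS _ pI)).
  exact: mcoeff_mulX_initial.
(* Only [p0] contributes to this coefficient: by minimality a contributing index has the same
   exponent, and at a different point its cofactor has zero constant term after translation. *)
split.
  rewrite hE (bigD1 p0) //= big1 ?addr0 => [|p /andP[pI pp0]].
    have [V -> V0] := translate_box_basis p0.2 (SB' _ s0S) (SB' _ s0S).
    rewrite mulf_neq0 // mulrC -[X in _@_X]addm0 mcoeffMX V0.
    by rewrite eqxx.
  apply/eqP; rewrite mulf_eq0; apply/negPn/negP; rewrite negb_or => /andP[dp cp].
  have pa : p.2 = p0.2.
    apply/val_inj/eqP/negPn/negP => /= /(ltw_total w).
    by rewrite (negPf (tb _ _ pI cp)) (negPf (pmin _ pI dp)).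
  have [V tV V0] := translate_box_basis p.2 (SB' _ s0S) (SB' _ (inS _ pI)).
  move: cp; rewrite tV pa mulrC -[X in _@_X]addm0 mcoeffMX V0 negbK => /eqP ps.
  by move: pp0; rewrite (surjective_pairing p) ps pa -surjective_pairing eqxx.
move=> b hb; have [p pI] : exists2 p, p \in box_index &
    d p * (translate p0.1 (box_basis p.1 p.2))@_b != 0.
  apply: contrapT => np; move: hb; rewrite hE big1 ?eqxx // => p pI.
  by apply/eqP/negPn/negP => hp; apply: np; exists p.
rewrite mulf_eq0 negb_or => /andP[dp /(tb _ _ pI) nb].
apply/negP => b0; have := pmin p pI dp.
have [e|ne] := eqVneq (bmnm p.2) b; first by rewrite e b0.
have := ltw_total w ne; rewrite (negPf nb) orbF => h1.
by rewrite (ltw_trans h1 b0).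
Qed.

(** By independence, distinct coefficient vectors give combinations that are incongruent modulo
    [P]. *)
Lemma box_index_card_le : (#|box_index| <= hilb P (W + \sum_i #|B i|))%N.
Proof.
have [Pid _ _] := Ppr; rewrite -(leq_hilb _ _ Pid).
pose E := {ffun {p | p \in box_index} -> k}.
have -> : (#|k| ^ #|box_index| = #|{: E}|)%N by rewrite card_ffun card_sig.
pose ext (c : E) p : k := if insub p is Some p' then c p' else 0.
pose phi (c : E) : R := \sum_(p in box_index) ext c p *: box_basis p.1 p.2.
apply: (card_le_hilb (phi := phi) Pid).
  move=> c; apply: msize_sum_leq => p; rewrite !inE => /andP[_ /andP[_ pW]].
  apply: (leq_trans (msizeZ_le _ _)); apply: (leq_trans (msize_box_basis _ _)).
  by rewrite -addSn leq_add2r.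
move=> c c'; rewrite /phi -sumrB (eq_bigr (fun p => (ext c p - ext c' p) *: box_basis p.1 p.2)).
  move/box_basis_independent => h; apply/ffunP => p.
  have := h (val p) (valP p); rewrite /ext valK.
  by move/eqP; rewrite subr_eq0 => /eqP.
by move=> p _; rewrite scalerBl.
Qed.

Lemma box_index_card : #|box_index| = (\sum_(s in S) #|weighted_simplex w (T s) W|)%N.
Proof.
rewrite -sum1_card (partition_big (fun p => p.1) (mem S)) => [|p]; last by rewrite inE => /andP[].
apply: eq_bigr => s sS; rewrite sum1dep_card.
have finj : injective (fun a : 'X_{1..N < W} => (s, a)) by move=> x y [].
rewrite -(card_imset _ finj); apply: eq_card => -[s' a]; rewrite inE.
apply/andP/imsetP => [[]|[a' aT [-> ->]]].
  by rewrite inE /= => /andP[_ aT] /eqP ss; exists a; rewrite -?ss.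
by rewrite inE /= aT andbT; split; [exact: sS | exact: eqxx].
Qed.

End Independence.

Variable H : {poly rat}.
Hypothesis hH : is_hilbert_poly P H.
Hypothesis szH : size H = n.+1.

Lemma translate_cobasis s : s \in S ->
  exists2 T : {set 'I_N}, #|T| = n & forall a, supported_in T a ->
    cobasis w (translate_ideal s P) a.
Proof.
move=> sS; have P'pr := translate_ideal_prime s Ppr.
have [Pid _ _] := Ppr; have [P'id _ _] := P'pr.
apply: (coordinate_cobasis (H := H)) => //.
  move=> f; rewrite /translate_ideal => /(SP sS).
  by rewrite -mcoeff0_translate translateNK.
by apply: eventually_imp hH => m ->; rewrite hilb_translate.
Qed.

(** Each point of [S] supplies a weighted simplex of independent elements; the growth in [m] of
    their total number is compared with that of the Hilbert polynomial through leading
    coefficients. *)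
Lemma point_bound (Pi : nat) :
  (forall T : {set 'I_N}, #|T| = n -> (\prod_(i in T) #|B i| <= Pi)%N) ->
  #|S|%:R <= n`!%:R * lead_coef H * Pi%:R.
Proof.
move=> hPi; have [Pid P1 _] := Ppr.
have lH : 0 < lead_coef H := hilbert_poly_lead_gt0 Pid P1 hH.
have [S0|S0] := eqVneq #|S| 0%N.
  by rewrite S0 !mulr_ge0 ?ler0n // ltW.
have ex s : exists T : {set 'I_N}, s \in S -> #|T| = n /\
    forall a, supported_in T a -> cobasis w (translate_ideal s P) a.
  have [sS|nS] := boolP (s \in S); last by exists finset.set0.
  by have [T h1 h2] := translate_cobasis sS; exists T.
have [T hT] := choice ex.
have hT2 s a : s \in S -> supported_in (T s) a -> cobasis w (translate_ideal s P) a.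
  by move=> /hT [_]; exact.
(* The constant [c] bounds the degree of the Lagrange factor in [box_basis]. *)
set c := (\sum_i #|B i|)%N.
have bound m : (#|S| * m.+1 ^ n <= n`! * Pi * hilb P (m + c).+1)%N.
  rewrite -addSn; apply: (@leq_trans (n`! * Pi * #|box_index T m.+1|)).
    rewrite box_index_card -sum_nat_const big_distrr /=; apply: leq_sum => s sS.
    have [Tn _] := hT s sS.
    have := weighted_simplex_card (T s) B_gt0 m; rewrite Tn => h.
    apply: (leq_trans h); rewrite -mulnA leq_mul2l [X in (_ <= X)%N]mulnC leq_mul2l hPi ?orbT //.
  by rewrite leq_mul2l box_index_card_le ?orbT.
have SR : #|S|%:R != 0 :> rat by rewrite pnatr_eq0.
(* Equality of sizes needs a nonzero scalar; [bound] at [m = 0] provides it, since [S] is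
   nonempty. *)
have nPi : (n`! * Pi)%:R != 0 :> rat.
  rewrite pnatr_eq0; apply/eqP => e; have := bound 0%N.
  by rewrite e mul0n exp1n muln1 leqn0 (negPf S0).
rewrite mulrAC -natrM -(lead_coef_shift H c%:R) (_ : #|S|%:R = lead_coef (#|S|%:R *: 'X^n)); last first.
  by rewrite lead_coefZ lead_coefXn mulr1.
rewrite -lead_coefZ; apply: lead_coef_le_eventually.
  by rewrite !size_scale // size_polyXn size_shift.
have e2 : eventually (fun m => H.[(m + c)%:R] = (hilb P (m + c).+1)%:R).
  by apply: (eventually_comp (f := addn^~ c) _ hH) => m; rewrite leq_addr.
apply: eventually_imp e2 => m h.
rewrite !hornerZ horner_comp !hornerE -natrD h -natrX -!natrM ler_nat.
by apply: leq_trans (bound m); rewrite leq_mul2l; apply/orP; right; case: (n) => // j; rewrite leq_exp2r.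
Qed.

End PointBound.

(** After the common factors are removed, equally many indices remain on both sides, and those from
    [T] all precede those from the top block; the maximum [M] separates their values. *)
Lemma sorted_prod_le N (b : 'I_N -> nat) (T : {set 'I_N}) :
  (forall i j : 'I_N, (i <= j)%N -> (b i <= b j)%N) ->
  (\prod_(i in T) b i <= \prod_(i < N | (N - #|T| <= i)%N) b i)%N.
Proof.
move=> bmono; set U := [set i : 'I_N | (N - #|T| <= i)%N].
have TN : (#|T| <= N)%N by rewrite -[X in (_ <= X)%N]card_ord max_card.
have cU : #|U| = #|T|.
  have := cardsC U; rewrite card_ord (_ : ~: U = [set i : 'I_N | (i < N - #|T|)%N]).
    rewrite card_ord_lt ?leq_subr //; lia.
  by apply/finset.setP => i; rewrite !inE -ltnNge.
rewrite [X in (_ <= X)%N](eq_bigl (fun i => i \in U)); last by move=> i; rewrite inE.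
rewrite [X in (X <= _)%N](big_setID U) [X in (_ <= X)%N](big_setID T) /= finset.setIC.
rewrite leq_mul2l; apply/orP; right.
have cD : #|T :\: U| = #|U :\: T|.
  apply/esym/eqP; have := cardsID T U; rewrite finset.setIC cU -[X in _ = X](cardsID U T) => /eqP.
  by rewrite eqn_add2l.
pose M := \max_(i in T :\: U) b i.
have TM i : i \in T :\: U -> (b i <= M)%N by move=> h; exact: leq_bigmax_cond.
have MU j : j \in U :\: T -> (M <= b j)%N.
  rewrite !inE => /andP[_ jU]; apply/bigmax_leqP => i; rewrite !inE -ltnNge => /andP[iU _].
  by apply: bmono; exact: leq_trans (ltnW iU) jU.
apply: (@leq_trans (M ^ #|T :\: U|)%N).
  by rewrite -prod_nat_const; apply: leq_prod.
by rewrite cD -prod_nat_const; apply: leq_prod.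
Qed.

(** * Primes and irreducible components *)

(** This is the ideal [I + (f)]. *)
Lemma ideal_add_generator (R : comNzRingType) (I : set R) f : is_ideal I ->
  is_ideal (fun h => exists a, I (h - a * f)).
Proof.
move=> Iid; split.
- by exists 0; rewrite mul0r subr0; exact: ideal0.
- move=> h h' [a ha] [a' ha']; exists (a + a').
  by rewrite mulrDl opprD addrACA; exact: idealD.
- by move=> b h [a ha]; exists (b * a); rewrite -mulrA -mulrBr; exact: ideal_mull.
Qed.

Section Noetherian.
Variables (N : nat) (k : fieldType).
Local Notation R := {mpoly k[N]}.

(** Each strict inclusion gives a normal form [g n] in [I n.+1] with leading monomial standard for
    [I n]. By Dickson's lemma some [mlead (g i)] divides a later [mlead (g j)], which is then not
    standard for [I j]. *)
Lemma mpoly_ascending_chain (I : nat -> set R) : (forall n, is_ideal (I n)) ->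
  (forall n, (I n `<=` I n.+1)%classic) -> exists n, I n.+1 = I n.
Proof.
move=> Iid Isub; apply: contrapT => nI.
have Imono m n : (m <= n)%N -> (I m `<=` I n)%classic.
  elim: n => [|n IH]; first by rewrite leqn0 => /eqP ->.
  by rewrite leq_eqVlt => /predU1P[->//|/IH h f /h /Isub].
have ex n : exists g, [/\ I n.+1 g, g != 0 & standard (I n) (mlead g)].
  have [f [Sf nf]] : exists f, I n.+1 f /\ ~ I n f.
    apply: contrapT => nf; apply: nI; exists n; apply/seteqP; split=> [f Sf|]; last exact: Isub.
    by apply: contrapT => nIf; apply: nf; exists f.
  have [Pg sg _] := normal_formP (Iid n) f; set g := normal_form (I n) f in Pg sg *.
  have g0 : g != 0.
    by apply/eqP => g0; apply: nf; move: Pg; rewrite g0 subr0.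
  exists g; split=> //; last exact/sg/mlead_supp.
  have -> : g = f - (f - g) by rewrite subKr.
  by apply: idealB => //; exact: Isub.
have [g hg] := choice ex.
have [i [j [ij le_ij]]] := dickson (fun n => mlead (g n)).
have [Ig g0 _] := hg i; have [_ _ sj] := hg j.
have := standard_le (Iid j) le_ij sj; apply/negP; rewrite negbK; apply/asboolP.
by exists (g i); split=> //; exact: Imono Ig.
Qed.

(** Noetherian induction: if [f * g] is in [J] but neither factor is, a prime over [J] contains [f]
    or [g], so lists for [J + (f)] and [J + (g)] combine. The list contains all minimal primes over
    [I] and possibly others. *)
Lemma finite_minimal_primes (I : set R) : is_ideal I ->
  exists2 Ps : seq (set R), {in Ps, forall P, is_prime_ideal P /\ (I `<=` P)%classic} &
    forall Q, is_prime_ideal Q -> (I `<=` Q)%classic ->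
      exists2 P, P \in Ps & (P `<=` Q)%classic.
Proof.
pose good (I : set R) := exists2 Ps : seq (set R),
    {in Ps, forall P, is_prime_ideal P /\ (I `<=` P)%classic} &
    forall Q, is_prime_ideal Q -> (I `<=` Q)%classic ->
      exists2 P, P \in Ps & (P `<=` Q)%classic.
rewrite -/(good I) => Iid; apply: contrapT => bad0.
have step (J : set R) : exists J' : set R, is_ideal J -> ~ good J ->
    [/\ is_ideal J', ~ good J', (J `<=` J')%classic & J' <> J].
  have [Jid|nJ] := pselect (is_ideal J); last by exists J.
  have [gJ|bJ] := pselect (good J); first by exists J.
  have J1 : ~ J 1.
    move=> J1; apply: bJ; exists [::] => // Q [_ Q1 _] JQ.
    by case: Q1; exact: JQ.
  have [[f g] [fg nf ng]] : exists p : R * R, [/\ J (p.1 * p.2), ~ J p.1 & ~ J p.2].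
    apply: contrapT => np; apply: bJ; exists [:: J].
      move=> P; rewrite inE => /eqP ->; split=> //; split=> // f g fg.
      have [|nf] := pselect (J f); first by left.
      right; apply: contrapT => ng; apply: np; by exists (f, g).
    by move=> Q _ JQ; exists J; rewrite ?inE.
  pose Jf h0 : set R := fun h => exists a, J (h - a * h0).
  have Jsub h0 : (J `<=` Jf h0)%classic by move=> h Jh; exists 0; rewrite mul0r subr0.
  have Jh0 h0 : Jf h0 h0 by exists 1; rewrite mul1r subrr; exact: ideal0.
  have Jfid h0 : is_ideal (Jf h0) by exact: ideal_add_generator.
  have ne h0 : ~ J h0 -> Jf h0 <> J by move=> nh e; apply: nh; rewrite -e; exact: Jh0.
  have [[Ps hPs cPs]|] := pselect (good (Jf f)); last by exists (Jf f); split=> //; exact: ne.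
  have [[Qs hQs cQs]|] := pselect (good (Jf g)); last by exists (Jf g); split=> //; exact: ne.
  case: bJ; exists (Ps ++ Qs) => [P|Q Qpr JQ].
    by rewrite mem_cat => /orP[/hPs|/hQs] [Ppr sP]; split=> // h /Jsub /sP.
  have [Qid _ QM] := Qpr.
  have sub h0 : Q h0 -> (Jf h0 `<=` Q)%classic.
    move=> Qh h [a /JQ ha]; rewrite -(subrK (a * h0) h).
    by apply: idealD => //; exact: ideal_mull.
  case: (QM f g (JQ _ fg)) => [/sub /(cPs _ Qpr)|/sub /(cQs _ Qpr)] [P PP PQ];
    by exists P; rewrite ?mem_cat ?PP ?orbT.
have [F hF] := choice step.
pose J n := iter n F I.
have Jbad n : is_ideal (J n) /\ ~ good (J n).
  by elim: n => // n [h1 h2]; have [h3 h4 _ _] := hF _ h1 h2.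
have [|n|n] := @mpoly_ascending_chain J.
- by move=> n; have [] := Jbad n.
- by have [h1 h2] := Jbad n; have [] := hF _ h1 h2.
- by have [h1 h2] := Jbad n; have [_ _ _] := hF _ h1 h2.
Qed.

End Noetherian.

Section PrimePoint.
Variables (R : comNzRingType) (P : set R).
Hypothesis Ppr : is_prime_ideal P.

Definition prime_pred : R -> bool := fun f => `[< P f >].

Lemma prime_pred_idealr_closed : idealr_closed prime_pred.
Proof.
have [Pid P1 _] := Ppr; split.
- by apply/asboolP; exact: ideal0.
- by apply/asboolP.
- move=> a f g /asboolP Pf /asboolP Pg; apply/asboolP; apply: idealD => //.
  exact: ideal_mull.
Qed.

Lemma prime_pred_prime : prime_idealr_closed prime_pred.
Proof.
have [_ _ PM] := Ppr; move=> f g /asboolP /PM [] h; apply/orP; [left|right]; exact/asboolP.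
Qed.

Lemma prime_idealr_of : exists p : prime_idealr R, forall f, f \in (p : pred _) <-> P f.
Proof.
pose I := isIdealr.Build R prime_pred prime_pred_idealr_closed.
pose M := isPrimeIdealrClosed.Build R prime_pred prime_pred_prime.
pose p : prime_idealr R := HB.pack prime_pred I M.
by exists p => f; split=> [/asboolP|h]; last exact/asboolP.
Qed.

End PrimePoint.

(** * Points, closed sets and prime ideals of affine space *)

Section AffineGeometry.
Local Open Scope classical_set_scope.
Variables (N : nat) (k : fieldType).
Local Notation R := {mpoly k[N]}.
Local Notation A := (affine_space k N).
Local Notation closed := (@affine_closed k N).
Implicit Types (p q : A) (Z : set A).

Definition point_ideal p : set R := [set f | f \in (p : pred _)].

Lemma point_ideal_prime p : is_prime_ideal (point_ideal p).
Proof.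
split; first split.
- exact: idealr0.
- by move=> f g fp gp; apply: rpredD.
- by move=> a f fp; apply: idealMr.
- by move=> p1; have := idealr1 p; rewrite [_ \in _]p1.
- by move=> f g; rewrite /point_ideal /= prime_idealrM => /orP.
Qed.

Lemma point_of_prime (P : set R) : is_prime_ideal P -> exists p, point_ideal p = P.
Proof.
move=> /prime_idealr_of [p hp]; exists p; apply/seteqP; split=> f /=; exact: (hp f).1 || exact: (hp f).2.
Qed.

(** The closure of the point [p]. *)
Definition specializations p : set A := affine_zeros (point_ideal p).

Lemma specializations_refl p : specializations p p.
Proof. by []. Qed.

Lemma affine_closed_specializations p : closed (specializations p).
Proof. by exists (point_ideal p). Qed.

Lemma closed_specialization C p q : closed C -> C p -> specializations p q -> C q.
Proof. by move=> [S ->] Sp pq f /Sp /pq. Qed.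

(** A closed set that contains the generic point [p] contains all of [Z]. *)
Lemma generic_irreducible Z p : Z p -> Z `<=` specializations p -> irreducible_set closed Z.
Proof.
move=> Zp Zs; split; first by exists p.
move=> C1 C2 cC1 cC2 /(_ p Zp) [h|h]; [left|right] => q /Zs;
  exact: closed_specialization h.
Qed.

Definition vanishing_ideal Z : set R := [set f | forall q, Z q -> point_ideal q f].

Lemma vanishing_ideal_prime Z : irreducible_set closed Z -> is_prime_ideal (vanishing_ideal Z).
Proof.
move=> [[z Zz] irr]; have pid q : is_ideal (point_ideal q) by case: (point_ideal_prime q).
split; first split.
- by move=> q _; exact: ideal0.
- by move=> f g hf hg q Zq; apply: idealD => //; [exact: hf | exact: hg].
- by move=> a f hf q Zq; apply: ideal_mull => //; exact: hf.
- by move=> /(_ z Zz); case: (point_ideal_prime z).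
- move=> f g fg; have cl h : closed (affine_zeros [set h]) by exists [set h].
  have [|h|h] := irr _ _ (cl f) (cl g).
  + move=> q /fg; have [_ _ qM] := point_ideal_prime q.
    by case/qM => h; [left|right] => x ->.
  + by left => q /h; apply.
  + by right => q /h; apply.
Qed.

Lemma closed_vanishing_ideal Z : closed Z -> Z = affine_zeros (vanishing_ideal Z).
Proof.
move=> [S ->]; apply/seteqP; split=> [q hq f|q hq f Sf]; first exact.
by apply: hq => r; exact.
Qed.

(** The two-set definition is iterated along the list, with finite unions of closed sets closed.
    Membership is [List.In] because [I] carries no equality operation. *)
Lemma irreducible_finite_union Z (I : Type) (s : seq I) (C : I -> set A) :
  irreducible_set closed Z -> (forall i, closed (C i)) ->
  (forall q, Z q -> exists2 i, List.In i s & C i q) -> exists2 i, List.In i s & Z `<=` C i.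
Proof.
move=> [[z Zz] irr] cC; elim: s => [|i s IH] cov; first by case: (cov z Zz).
have closedU (D E : set A) : closed D -> closed E -> closed (D `|` E).
  (* The union of two zero sets is the zero set of the pairwise products, as points are prime
     ideals. *)
  move=> [S ->] [T ->]; exists [set h | exists f g, [/\ S f, T g & h = f * g]].
  apply/seteqP; split => q.
    move=> hq _ [f [g [Sf Tg ->]]]; have [qid _ _] := point_ideal_prime q.
    by case: hq => hq; [apply: (ideal_mulr qid); exact: hq | apply: (ideal_mull qid); exact: hq].
  move=> hq; have [h|nh] := pselect (affine_zeros S q); first by left.
  right=> g Tg; apply: contrapT => ng; apply: nh => f Sf.
  have [_ _ qM] := point_ideal_prime q.
  by case: (qM f g) => //; apply: hq; exists f, g.
have closedL (t : seq I) : closed [set q | exists2 i, List.In i t & C i q].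
  elim: t => [|j t IHt].
    exists [set 1]; apply/seteqP; split=> q; first by case.
    by move=> /(_ 1 erefl); have [_ q1 _] := point_ideal_prime q.
  rewrite (_ : [set q | _] = C j `|` [set q | exists2 i, List.In i t & C i q]); first exact: closedU.
  apply/seteqP; split=> q.
    by move=> [l [<-|lt]] Cl; [left | right; exists l].
  by move=> [Cj|[l lt Cl]]; [exists j => //; left | exists l => //; right].
have [||h] := irr (C i) [set q | exists2 i, List.In i s & C i q] (cC i) (closedL s).
- by move=> q /cov [l [<-|ls]] Cl; [left | right; exists l].
- by move=> h; exists i => //; left.
- by have [j js Zj] := IH h; exists j => //; right.
Qed.

End AffineGeometry.

(** Minimality is that of a preorder: an element below [x] is only equivalent to it. *)
Lemma list_minimal (T : Type) (le : T -> T -> Prop) (A : T -> Prop) (s : seq T) :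
  (forall x y z, le x y -> le y z -> le x z) ->
  (exists2 x, List.In x s & A x) ->
  exists x, [/\ List.In x s, A x & forall y, List.In y s -> A y -> le y x -> le x y].
Proof.
move=> le_trans; elim: s => [|x s IH] [y]; first by case.
move=> ys Ay; have [/IH [m [ms Am mmin]]|ns] := pselect (exists2 y, List.In y s & A y).
  have [[Ax xm]|nx] := pselect (A x /\ le x m).
    exists x; split=> //; first by left.
    move=> z [<-//|zs] Az zx; apply: (le_trans _ m) => //.
    by apply: mmin => //; exact: le_trans xm.
  exists m; split=> //; first by right.
  by move=> z [<-|zs] Az zm; [case: nx | exact: mmin].
exists x; case: ys Ay => [<-|ys] Ay; last by case: ns; exists y.
split=> //; first by left.
move=> z [<-//|zs] Az; by case: ns; exists z.
Qed.

(** * Irreducible components of a subscheme *)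

Section Components.
Local Open Scope classical_set_scope.
Variables (N : nat) (k : fieldType) (X : subscheme k N).
Local Notation closed := (@affine_closed k N).
Implicit Types (p q : affine_space k N) (Z : set (affine_space k N)).

(** The removed set is closed, so a point with a specialization outside it lies outside it too. *)
Lemma support_generic p z : affine_zeros (sub_ideal X) p -> specializations p z ->
  Defs.support X z -> Defs.support X p.
Proof. by move=> Ip pz [_ nz]; split=> // Jp; apply: nz => f /Jp /pz. Qed.

(** The points are finitely many primes over [sub_ideal X], the minimal ones included; some may lie
    in the removed closed set. *)
Lemma support_generators : exists2 ps : seq (affine_space k N),
  forall p, List.In p ps -> affine_zeros (sub_ideal X) p &
  forall q, Defs.support X q -> exists2 p, List.In p ps & specializations p q.
Proof.
have [Ps hPs cPs] := finite_minimal_primes (sub_ideal_is_ideal X).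
have [ps h1 h2] : exists2 ps : seq (affine_space k N),
    forall p, List.In p ps -> point_ideal p \in Ps &
    forall P, P \in Ps -> exists2 p, List.In p ps & point_ideal p = P.
  elim: Ps hPs {cPs} => [|P Ps IH] hPs; first by exists [::].
  have [Q QPs|ps h1 h2] := IH; first by apply: hPs; rewrite inE QPs orbT.
  have [|/point_of_prime [p pP] _] := hPs P; first by rewrite inE eqxx.
  exists (p :: ps) => [q [<-|/h1 qs]|Q]; rewrite ?inE.
  - by rewrite pP eqxx.
  - by rewrite qs orbT.
  - move=> /predU1P[->|/h2 [q qs qQ]]; first by exists p => //; left.
    by exists q => //; right.
exists ps => [p /h1 /hPs [_ sP]|q [Iq _]]; first by move=> f /sP.
have [P /h2 [p pps pP] Pq] := cPs _ (point_ideal_prime q) Iq.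
by exists p => //; rewrite /specializations pP.
Qed.

Lemma generic_component_irreducible p : Defs.support X p ->
  irreducible_set closed (specializations p `&` Defs.support X).
Proof.
move=> sp; apply: (generic_irreducible (p := p)); last by move=> q [].
by split=> //; exact: specializations_refl.
Qed.

(** By irreducibility [Z] lies in the closure of one of the finitely many points; the trace of this
    closure on the support is irreducible, so maximality gives equality. *)
Lemma component_generic Z : components X Z ->
  exists2 p, Z p & Z = specializations p `&` Defs.support X.
Proof.
move=> [ZX irr Zmax]; have [ps psI cov] := support_generators.
have [p pps Zp] := irreducible_finite_union irr (@affine_closed_specializations N k)
  (fun q Zq => cov q (ZX q Zq)).
have [[z Zz] _] := irr.
have sp : Defs.support X p := support_generic (psI p pps) (Zp z Zz) (ZX z Zz).
have ZE : specializations p `&` Defs.support X = Z.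
  apply: Zmax; first by move=> q [].
    exact: generic_component_irreducible.
  by move=> q Zq; split; [exact: Zp | exact: ZX].
by exists p; rewrite -ZE //; split=> //; exact: specializations_refl.
Qed.

Lemma components_finite : finite_set (components X).
Proof.
have [ps psI cov] := support_generators.
pose C p := specializations p `&` Defs.support X.
apply: (sub_finite_set (B := [set` [seq C p | p <- ps]])); last exact: finite_seq.
move=> Z cZ; have [p Zp ZE] := component_generic cZ.
have [ZX [_ irr] Zmax] := cZ; rewrite /=.
have [q qps qp] := cov p (ZX p Zp).
have sq : Defs.support X q := support_generic (psI q qps) qp (ZX p Zp).
have <- : C q = Z.
  apply: Zmax; first by move=> r [].
    exact: generic_component_irreducible.
  by move=> r; rewrite ZE => -[pr sr]; split=> // f /qp /pr.
by elim: ps qps {psI cov} => //= x s IH [->|/IH h]; rewrite inE ?eqxx // h orbT.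
Qed.

(** Among the listed points that specialize to [q], one with minimal ideal is taken. A larger
    irreducible set lies in the closure of a listed point that specializes to it, hence in its own
    closure. *)
Lemma component_cover q : Defs.support X q -> exists2 Z, components X Z & Z q.
Proof.
move=> sq; have [ps psI cov] := support_generators.
have [p [pps pq pmin]] := list_minimal
  (le := fun p p' : affine_space k N => specializations p p')
  (fun x y z (xy : specializations x y) (yz : specializations y z) =>
     (fun f fx => yz f (xy f fx)) : specializations x z) (cov q sq).
have sp : Defs.support X p := support_generic (psI p pps) pq sq.
exists (specializations p `&` Defs.support X); last by split.
split; first by move=> r [].
  exact: generic_component_irreducible.
move=> Z' Z'X irr' sub.
have [p' p'ps Z'p'] := irreducible_finite_union irr' (@affine_closed_specializations N k)
  (fun q Zq => cov q (Z'X q Zq)).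
have p'p : specializations p' p.
  by apply/Z'p'/sub; split=> //; exact: specializations_refl.
have pp' : specializations p p'.
  by apply: pmin => // f /p'p /pq.
apply/seteqP; split=> // r Z'r; split; last exact: Z'X.
by move=> f /pp'; exact: (Z'p' r Z'r).
Qed.

Lemma closure_component p Z : Z p -> Z `<=` specializations p ->
  smallest closed Z = specializations p.
Proof.
move=> Zp Zs; apply/seteqP; split.
  exact: smallest_sub (affine_closed_specializations p) Zs.
by move=> q pq C [cC ZC]; exact: closed_specialization (ZC p Zp) pq.
Qed.

End Components.

(** * Codimension and Hilbert polynomials *)

Section Codimension.
Local Open Scope classical_set_scope.
Variables (N : nat) (k : finFieldType).

(** The chain gives strictly decreasing prime ideals, along which the degree of the Hilbert
    polynomial strictly rises, and this degree is at most [N]. *)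
Lemma chain_hilbert_poly_size (p : affine_space k N) n (H : {poly rat}) :
  has_chain_above (specializations p) n -> is_hilbert_poly (point_ideal p) H ->
  (size H + n <= N.+1)%N.
Proof.
move=> [Zs [Z0 Zirr Zlt]] hH.
pose I i := vanishing_ideal (Zs i).
have Ipr i : (i <= n)%N -> is_prime_ideal (I i).
  by move=> /Zirr [_ /vanishing_ideal_prime].
have Ilt i : (i < n)%N -> I i.+1 `<` I i.
  move=> ni; have [sub nsub] := Zlt i ni; split; first by move=> f hf q /sub /hf.
  move=> h; apply: nsub; have [/closed_vanishing_ideal -> _] := Zirr i.+1 ni.
  have [/closed_vanishing_ideal -> _] := Zirr i (ltnW ni).
  by move=> q hq f /h; exact: hq.
(* The induction starts from the smallest prime, [I n], and descends to [I 0]. *)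
have main j : (j <= n)%N -> forall H, is_hilbert_poly (I (n - j)%N) H ->
    (size H + j <= N.+1)%N.
  elim: j => [|j IH] jn H' hH'.
    have [Iid I1 _] := Ipr n (leqnn n); rewrite addn0.
    by apply: (size_hilbert_poly_le Iid I1); rewrite -[n]subn0.
  have e : (n - j = (n - j.+1).+1)%N by rewrite subnSK.
  have lt : (n - j.+1 < n)%N by rewrite ltn_subrL (leq_trans _ jn).
  have Ppr : is_prime_ideal (I (n - j)%N) by apply: Ipr; exact: leq_subr.
  have [Qid Q1 _] : is_prime_ideal (I (n - j.+1)%N) by apply: Ipr; exact: leq_subr.
  have [Pid _ _] := Ppr.
  have [K hK] := hilbert_poly_exists Pid.
  have := IH (ltnW jn) K hK; apply: leq_trans; rewrite addnS -addSn leq_add2r.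
  by apply: (size_hilbert_poly_lt Ppr Qid Q1 _ hK hH'); rewrite e; exact: Ilt.
apply: (main n (leqnn n)); rewrite subnn.
have -> // : I 0%N = point_ideal p.
rewrite /I Z0; apply/seteqP; split=> f; last by move=> fp q; apply.
by apply; exact: specializations_refl.
Qed.

(** [theta] is compared only with codimensions that exist. Chain lengths above [Z] are bounded by
    the previous lemma, so a longest chain exists and has length at least [theta]. *)
Lemma codim_hilbert_poly_size (X : subscheme k N) theta (p : affine_space k N) Z H :
  codim_is X theta -> components X Z -> Z p -> Z = specializations p `&` Defs.support X ->
  is_hilbert_poly (point_ideal p) H -> (size H + theta <= N.+1)%N.
Proof.
move=> [_ theta_min] cZ Zp ZE hH.
have cl : smallest (@affine_closed k N) Z = specializations p.
  by apply: closure_component => //; rewrite ZE => q [].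
pose A n := `[< has_chain_above (smallest (@affine_closed k N) Z) n >].
have bound n : A n -> (n <= N.+1)%N.
  move=> /asboolP; rewrite cl => /chain_hilbert_poly_size /(_ hH).
  by apply: leq_trans; exact: leq_addl.
have exA : exists n, A n.
  exists 0%N; apply/asboolP; exists (fun=> specializations p); split=> //.
  move=> i _; split; first exact: affine_closed_specializations.
  by apply: (generic_irreducible (p := p)); first exact: specializations_refl.
have [n /asboolP hn nmax] := ex_maxnP exA bound.
have : irreducible_codim_is Z n.
  by split=> // m hm; apply: nmax; apply/asboolP.
move=> /(theta_min Z n cZ) tn.
move: hn; rewrite cl => /chain_hilbert_poly_size /(_ hH); apply: leq_trans.
by rewrite leq_add2l.
Qed.

End Codimension.

(** * Degree *)

(** Extending a prime ideal to polynomials keeps it prime: the lowest coefficients outside [P]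
    multiply to a coefficient outside [P], as in Gauss's lemma. *)
Lemma poly_prime_coef (R : comNzRingType) (P : set R) (f g : {poly R}) :
  is_prime_ideal P -> (forall i, P (f * g)`_i) ->
  (forall i, P f`_i) \/ (forall i, P g`_i).
Proof.
move=> [Pid _ PM] hfg.
have least (h : {poly R}) : ~ (forall i, P h`_i) ->
    exists2 i, ~ P h`_i & forall j, (j < i)%N -> P h`_j.
  move=> nh; have ex : exists i, ~~ `[< P h`_i >].
    apply: contrapT => ni; apply: nh => i; apply: contrapT => nPi.
    by apply: ni; exists i; apply/asboolP.
  have [i /asboolP ni imin] := ex_minnP ex; exists i => // j ji.
  apply: contrapT => nj; have hj : ~~ `[< P h`_j >] by apply/negP => /asboolP.
  by have := imin j hj; rewrite leqNgt ji.
apply: contrapT => no.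
have [|i nfi fmin] := least f; first by move=> h; apply: no; left.
have [|j ngj gmin] := least g; first by move=> h; apply: no; right.
have := hfg (i + j)%N; rewrite coefM.
have ltij : (i < (i + j).+1)%N by rewrite ltnS leq_addr.
rewrite (bigD1 (Ordinal ltij)) //= addKn => hs.
have h2 : P (\sum_(l < (i + j).+1 | l != Ordinal ltij) f`_l * g`_(i + j - l)).
  apply: ideal_sum => // l; rewrite -val_eqE /= neq_ltn => /orP[li|il].
    by apply: ideal_mulr => //; exact: fmin.
  by apply: ideal_mull => //; apply: gmin; have := ltn_ord l; lia.
have := idealB Pid hs h2; rewrite addrK.
by case/PM.
Qed.

(** * Dehomogenization and the affine chart *)

Section Dehomogenization.
Variables (N : nat) (k : fieldType).
Local Notation R := {mpoly k[N]}.
Local Notation S := {mpoly k[N.+1]}.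
Implicit Types (F G : S).

Definition dehom_var (i : 'I_N.+1) : R := oapp (fun j => 'X_j) 1 (unlift ord0 i).

Lemma dehomogenizeE F :
  dehomogenize F = \sum_(a <- msupp F) (F@_a)%:MP * \prod_(i < N.+1) dehom_var i ^+ a i.
Proof.
rewrite /dehomogenize comp_mpolyE; apply: eq_bigr => a _.
rewrite mul_mpolyC; congr (_ *: _); apply: eq_bigr => i _.
by rewrite tnth_mktuple.
Qed.

Lemma dehomogenize_linear : linear (@dehomogenize k N).
Proof. by move=> c F G; rewrite /dehomogenize comp_mpolyD comp_mpolyZ. Qed.

Lemma prod_dehom_var (a : 'X_{1..N.+1}) :
  \prod_(i < N.+1) dehom_var i ^+ a i = 'X_[mnm_dehomog a].
Proof.
rewrite big_ord_recl /dehom_var unlift_none /= expr1n mul1r mpolyXE_id.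
by apply: eq_bigr => i _; rewrite liftK /= mnmE.
Qed.

Lemma dehomogenizeX (a : 'X_{1..N.+1}) : dehomogenize ('X_[a] : S) = 'X_[mnm_dehomog a].
Proof.
rewrite /dehomogenize comp_mpolyX -prod_dehom_var.
by apply: eq_bigr => i _; rewrite tnth_mktuple.
Qed.

Lemma msize_dehomogenize F m : F \is m.-homog -> (msize (dehomogenize F) <= m.+1)%N.
Proof.
move=> /dhomogP hF; rewrite dehomogenizeE big_seq; apply: msize_sum_leq => a /hF am.
rewrite mul_mpolyC; apply: (leq_trans (msizeZ_le _ _)).
by rewrite prod_dehom_var msizeX ltnS -am [X in (_ <= X)%N]mdeg_dehomog leq_addl.
Qed.

(* [F(t, t x_1, ..., t x_N)]. *)
Definition cone_poly (F : S) : {poly R} :=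
  mmap (polyC \o @mpolyC N k) (fun i => (dehom_var i)%:P * 'X) F.

HB.instance Definition _ := GRing.RMorphism.copy cone_poly
  (mmap (polyC \o @mpolyC N k) (fun i => (dehom_var i)%:P * 'X)).

Lemma cone_polyD F G : cone_poly (F + G) = cone_poly F + cone_poly G.
Proof. exact: rmorphD. Qed.

Lemma cone_polyM F G : cone_poly (F * G) = cone_poly F * cone_poly G.
Proof. exact: rmorphM. Qed.

Lemma cone_poly_homog F m : F \is m.-homog -> cone_poly F = (dehomogenize F)%:P * 'X^m.
Proof.
move=> /dhomogP hF; rewrite /cone_poly /mmap dehomogenizeE rmorph_sum mulr_suml.
rewrite big_seq [RHS]big_seq; apply: eq_bigr => a /hF am /=.
have {}am : mdeg a = m by [].
rewrite polyCM -mulrA; congr (_ * _); rewrite /mmap1 -am mdegE.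
rewrite [LHS](eq_bigr (fun i => (dehom_var i)%:P ^+ a i * 'X ^+ a i)); last first.
  by move=> i _; rewrite exprMn.
rewrite big_split /= rmorph_prod /=; congr (_ * _).
  by apply: eq_bigr => i _; rewrite rmorphXn.
by rewrite prodrXr.
Qed.

Lemma coef_cone_poly F m : (cone_poly F)`_m = dehomogenize (pihomog mdeg m F).
Proof.
have Fm : (msize F <= maxn (msize F) m.+1)%N := leq_maxl _ _.
rewrite [F in LHS](pihomog_partitionE Fm) rmorph_sum coef_sum /=.
have mK : (m < maxn (msize F) m.+1)%N := leq_maxr _ _.
rewrite (bigD1 (Ordinal mK)) //= big1 => [|d dm].
  by rewrite (cone_poly_homog (pihomogP _ _ _)) coefCM coefXn eqxx mulr1 addr0.
rewrite (cone_poly_homog (pihomogP _ _ _)) coefCM coefXn.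
by rewrite eq_sym -[(_ == m)]/(d == Ordinal mK) (negPf dm) mulr0.
Qed.

(** The point is the kernel of the map sending [F] to [cone_poly F] with coefficients modulo [p].
    The powers of the extra variable separate homogeneous components, so this prime is homogeneous;
    it is relevant because ['X_ord0] dehomogenizes to 1. *)
Lemma chart_exists (p : affine_space k N) : exists q, chart p q.
Proof.
have ppr := point_ideal_prime p; have [pid p1 pM] := ppr.
pose Q : set S := fun F => forall i, point_ideal p (cone_poly F)`_i.
have Qpr : is_prime_ideal Q.
  split; first split.
  - by move=> i; rewrite /cone_poly mmap0 coef0; exact: ideal0.
  - by move=> F G hF hG i; rewrite cone_polyD coefD; exact: (idealD pid (hF i) (hG i)).
  - move=> F G hG i; rewrite cone_polyM coefM; apply: (ideal_sum pid) => j _.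
    exact: (ideal_mull pid _ (hG _)).
  - by move=> /(_ 0%N); rewrite /cone_poly rmorph1 coef1.
  - by move=> F G hFG; apply: (poly_prime_coef ppr) => i; rewrite -cone_polyM; exact: hFG.
have [q hq] := prime_idealr_of Qpr.
have homogQ F m : F \is m.-homog -> F \in (q : pred _) <-> dehomogenize F \in (p : pred _).
  move=> hF; split=> [/hq /(_ m)|h]; first by rewrite (cone_poly_homog hF) coefCM coefXn eqxx mulr1.
  apply/hq => i; rewrite (cone_poly_homog hF) coefCM; exact: (ideal_mulr pid).
have hhom F m : F \in (q : pred _) -> pihomog mdeg m F \in (q : pred _).
  move=> /hq hF; apply/(homogQ _ _ (pihomogP _ _ _)); rewrite -coef_cone_poly; exact: hF.
have hrel : exists i : 'I_N.+1, 'X_i \notin (q : pred _).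
  have hX : ('X_ord0 : S) \is 1.-homog by rewrite dhomogX; apply/eqP; exact: mdeg1.
  exists ord0; apply/negP => /(homogQ _ _ hX).
  rewrite dehomogenizeX (_ : mnm_dehomog _ = 0%MM) ?mpolyX0 ?idealr1 //.
  by apply/mnmP => i; rewrite !mnmE.
by exists (ProjPoint hhom hrel) => m F hF; apply/idP/idP => /(homogQ _ _ hF).
Qed.

End Dehomogenization.

Section Degree.
Variables (N : nat) (k : fieldType) (p : affine_space k N).
Local Notation P := (point_ideal p).
Local Notation R := {mpoly k[N]}.

Let Pid : is_ideal P. Proof. by case: (point_ideal_prime p). Qed.

(** The class of the dehomogenized form modulo [P], in coordinates for the standard monomials; its
    kernel will be the space of vanishing forms. *)
Definition standard_part m (F : dhomog N.+1 k m) : 'rV[k]_(#|{: std_mon P m.+1}|) :=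
  \row_j (normal_form P (dehomogenize F))@_(std_mnm (enum_val j)).

Lemma standard_part_linear m : linear (@standard_part m).
Proof.
move=> c F G; apply/rowP => j; rewrite !mxE.
by rewrite dehomogenize_linear normal_form_linear // mcoeffD mcoeffZ.
Qed.

HB.instance Definition _ m := GRing.isLinear.Build k (dhomog N.+1 k m) _ _ (@standard_part m)
  (@standard_part_linear m).

Lemma standard_part_eq0 m (F : dhomog N.+1 k m) : standard_part F = 0 <-> P (dehomogenize F).
Proof.
have szF := msize_dehomogenize (dhomog_is_dhomog F).
split=> [/rowP h|h].
  rewrite -[dehomogenize F]subr0; apply: normal_form_eqP => //.
  rewrite -(nf_coordsK Pid szF) [RHS]normal_form_id //.
    rewrite /of_coords big1 // => a _; rewrite ffunE.
    by have := h (enum_rank a); rewrite !mxE enum_rankK => ->; rewrite scale0r.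
  by rewrite msupp0.
apply/rowP => j; rewrite !mxE (normal_form_eq Pid (g := 0)) ?subr0 //.
rewrite normal_form_id ?mcoeff0 //.
by rewrite msupp0.
Qed.

(** Standard monomials of degree at most [m] are homogenized to degree [m]. *)
Lemma standard_part_surj m (v : 'rV[k]_(#|{: std_mon P m.+1}|)) :
  exists F : dhomog N.+1 k m, standard_part F = v.
Proof.
pose c : {ffun std_mon P m.+1 -> k} := [ffun a => v 0 (enum_rank a)].
pose F : {mpoly k[N.+1]} := \sum_a c a *: 'X_[mnm_homog m (std_mnm a)].
have hF : F \is m.-homog.
  apply: rpred_sum => a _; apply: rpredZ; rewrite dhomogX; apply/eqP.
  by apply: mdeg_homog; rewrite -ltnS; exact: bmdeg.
have dF : dehomogenize F = of_coords c.
  rewrite /F /dehomogenize raddf_sum; apply: eq_bigr => a _ /=.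
  by rewrite comp_mpolyZ [X in _ *: X]dehomogenizeX mnm_homogK.
exists (DHomog hF); apply/rowP => j; rewrite mxE /= dF normal_form_id //.
  by rewrite mcoeff_of_coords ffunE enum_valK.
by move=> a /msupp_of_coords [].
Qed.

Variable Z : set (affine_space k N).
Hypothesis Zp : Z p.
Hypothesis Zs : (Z `<=` specializations p)%classic.

(** In one direction the form is tested at the image of the generic point [p]; in the other, its
    zero set is closed and contains the image of [Z]. *)
Lemma proj_closure_vanishing m (F : {mpoly k[N.+1]}) : F \is m.-homog ->
  (forall q, proj_closure Z q -> F \in (proj_ideal q : pred _)) <-> P (dehomogenize F).
Proof.
move=> hF; split=> [h|h q].
  have [q pq] := chart_exists p.
  rewrite /point_ideal /= -(pq m F hF); apply: h => C [_ ZC]; apply: ZC.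
  by exists p.
move=> /(_ (proj_zeros [set F])); apply=> //; split; first by exists [set F]%classic.
move=> r [p' Zp' /(_ m F hF) e] G -> /=; rewrite e.
exact: Zs Zp' _ h.
Qed.

(** Rank-nullity for [standard_part]: the projective Hilbert function of the closure is the affine
    one of [P]. *)
Lemma hilbert_functionE m : hilbert_function (proj_closure Z) m = hilb P m.+1.
Proof.
rewrite /hilbert_function.
have -> : vanishing_forms (proj_closure Z) m = lker (linfun (@standard_part m)).
  rewrite /vanishing_forms; set A := [set U | _]%classic.
  have Aker : A (lker (linfun (@standard_part m))).
    move=> F; rewrite memv_ker lfunE; split=> [/eqP /standard_part_eq0|].
      by move/(proj_closure_vanishing (dhomog_is_dhomog F)).
    by move/(proj_closure_vanishing (dhomog_is_dhomog F))/standard_part_eq0/eqP.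
  apply/vspaceP => F.
  have AU := xgetPex 0%VS (ex_intro A _ Aker).
  by apply/idP/idP => [/(AU F)|/(Aker F)] h; [apply/(Aker F) | apply/(AU F)].
have := limg_ker_dim (linfun (@standard_part m)) fullv.
rewrite capfv => <-; rewrite addKn.
have -> : (linfun (@standard_part m) @: fullv)%VS = fullv.
  apply/vspaceP => v; rewrite memvf; have [F <-] := standard_part_surj v.
  by rewrite -[standard_part F]lfunE memv_img // memvf.
by rewrite dimvf /dim /= mul1n card_std_mon.
Qed.

(** A polynomial is determined by its values at large integers, so the choice made in
    [hilbert_polynomial] must be [H]. *)
Lemma degreeE H : is_hilbert_poly P H -> degree Z = ((size H).-1)`!%:R * lead_coef H.
Proof.
move=> hH; rewrite /degree /proj_degree.
suff -> : hilbert_polynomial (proj_closure Z) = H by [].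
rewrite /hilbert_polynomial; set A := [set P | _]%classic.
have AH : A H.
  by have [m0 hm] := hH; exists m0 => m /hm ->; rewrite hilbert_functionE.
have [m0 hm] := xgetPex 0 (ex_intro A _ AH).
apply: poly_eq_eventually; have [m1 hm1] := AH.
exists (maxn m0 m1) => m; rewrite geq_max => /andP[/hm -> /hm1 ->].
by [].
Qed.

End Degree.

(** * The bound *)

Lemma card_cover_le (T : finType) (I : eqType) (S : {set T}) (s : seq I) (F : I -> {set T}) :
  (forall x, x \in S -> exists2 i, i \in s & x \in F i) ->
  (#|S| <= \sum_(i <- s) #|F i|)%N.
Proof.
move=> cov; rewrite -sum1_card; apply: (@leq_trans (\sum_(x in S) \sum_(i <- s) (x \in F i))).
  apply: leq_sum => x /cov [i si xi].
  by rewrite (big_rem i) //= xi.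
rewrite exchange_big /=; apply: leq_sum => i _.
rewrite -sum1_card [X in (_ <= X)%N]big_mkcond /= big_mkcond /=; apply: leq_sum => x _.
by case: (x \in S); case: (x \in F i).
Qed.

Section RationalPoints.
Variables (N : nat) (k : fieldType).

(** The point is the kernel of evaluation at [x]. *)
Lemma rational_point_exists (x : {ffun 'I_N -> k}) :
  exists p : affine_space k N, forall f, point_ideal p f <-> f.@[x] = 0.
Proof.
have : is_prime_ideal [set f : {mpoly k[N]} | f.@[x] = 0]%classic.
  split; first split => /=.
  - by rewrite meval0.
  - by move=> f g hf hg; rewrite mevalD hf hg addr0.
  - by move=> a f hf; rewrite mevalM hf mulr0.
  - by rewrite /= meval1 => /eqP; rewrite oner_eq0.
  - by move=> f g /=; rewrite mevalM => /eqP; rewrite mulf_eq0 => /orP[] /eqP; [left|right].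
by move=> /point_of_prime [p hp]; exists p => f; rewrite hp.
Qed.

Lemma support_rational (X : subscheme k N) (x : {ffun 'I_N -> k}) (p : affine_space k N) :
  (forall f, point_ideal p f <-> f.@[x] = 0) -> rational_points X x -> Defs.support X p.
Proof.
move=> hp [h1 [g Jg gx]]; split; first by move=> f /h1 /hp.
by move=> /(_ g Jg) /hp /eqP; rewrite (negPf gx).
Qed.

End RationalPoints.

Section Assembly.
Variables (N theta : nat) (k : finFieldType) (X : subscheme k N) (B : 'I_N -> {set k}).
Hypothesis hcodim : codim_is X theta.
Hypothesis B_gt0 : forall i, (0 < #|B i|)%N.
Hypothesis B_mono : forall i j : 'I_N, (i <= j)%N -> (#|B i| <= #|B j|)%N.

(** [point_bound] is applied to the generic prime of [Z], with the product of the [n] largest side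
    lengths as the bound over all sets [T]. *)
Lemma component_bound Z (S : {set {ffun 'I_N -> k}})
    (pt : {ffun 'I_N -> k} -> affine_space k N) :
  (forall x f, point_ideal (pt x) f <-> f.@[x] = 0) -> components X Z ->
  S \subset box B -> (forall x, x \in S -> Z (pt x)) ->
  #|S|%:R <= degree Z * \prod_(i < N | (theta <= i)%N) #|B i|%:R.
Proof.
move=> hpt cZ SB SZ; have [p Zp ZE] := component_generic cZ.
have Zs : (Z `<=` specializations p)%classic by rewrite ZE => q [].
have ppr := point_ideal_prime p; have [pid p1 _] := ppr.
have [H hH] := hilbert_poly_exists pid.
have lH := hilbert_poly_lead_gt0 pid p1 hH.
have szH := codim_hilbert_poly_size hcodim cZ Zp ZE hH.
rewrite (degreeE Zp Zs hH); set n := (size H).-1.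
have szHn : size H = n.+1.
  by rewrite prednK // size_poly_gt0 -lead_coef_eq0 gt_eqF.
have SP s f : s \in S -> point_ideal p f -> f.@[s] = 0.
  by move=> sS pf; apply/hpt; exact: Zs (SZ s sS) f pf.
have hPi (T : {set 'I_N}) : #|T| = n ->
    (\prod_(i in T) #|B i| <= \prod_(i < N | (N - n <= i)%N) #|B i|)%N.
  by move=> <-; exact: sorted_prod_le.
apply: (le_trans (point_bound B_gt0 ppr SB SP hH szHn hPi)).
rewrite ler_pM2l; last by rewrite mulr_gt0 // ltr0n fact_gt0.
(* Since [n + theta] is at most [N], the product from [theta] on has at least the factors from
   [N - n] on, and the additional ones are at least 1. *)
rewrite -natr_prod ler_nat [X in (_ <= X)%N](bigID (fun i : 'I_N => (N - n <= i)%N)) /=.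
rewrite (eq_bigl (fun i : 'I_N => (theta <= i)%N && (N - n <= i)%N)).
  by rewrite leq_pmulr // prodn_gt0.
move=> i; case: leqP => h; rewrite ?andbF ?andbT //.
by apply/esym; apply: leq_trans h; move: szH; rewrite szHn; lia.
Qed.

(** The finitely many components cover the points, and [component_bound] is summed over them; a
    point on several components may be counted repeatedly. *)
Lemma rational_points_bound :
  #|[set x in box B | `[< rational_points X x >]]%SET|%:R
    <= degree_sum X * \prod_(i < N | (theta <= i)%N) #|B i|%:R.
Proof.
have [pt hpt] := choice (@rational_point_exists N k).
set S := [set x in box B | _]%SET.
have fin := components_finite X.
rewrite /degree_sum fsbig_finite //= mulr_suml.
pose F Z := [set x in S | `[< Z (pt x) >]]%SET.
apply: (@le_trans _ _ (\sum_(Z <- finmap.enum_fset (fset_set (components X))) #|F Z|%:R)).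
  rewrite -natr_sum ler_nat; apply: card_cover_le => x xS.
  have [Z cZ Zx] : exists2 Z, components X Z & Z (pt x).
    apply: component_cover; apply: support_rational (hpt x) _.
    by move: xS; rewrite inE => /andP[_ /asboolP].
  exists Z; first by rewrite in_fset_set //; apply/mem_set.
  by rewrite inE xS; apply/asboolP.
rewrite big_seq [X in _ <= X]big_seq; apply: ler_sum => Z.
rewrite in_fset_set // => /set_mem cZ.
apply: (component_bound hpt cZ).
  by apply/fintype.subsetP => x; rewrite !inE => /andP[/andP[]].
by move=> x; rewrite inE => /andP[_ /asboolP].
Qed.

End Assembly.

(* The indices [1, ..., N] of the informal statement are [0, ..., N-1] here. *)
Theorem lemma1p5 (k : finFieldType) (N theta : nat) (X : subscheme k N) (d : rat)
    (B : 'I_N -> {set k}) :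
  codim_is X theta ->
  d = degree_sum X ->
  (forall i : 'I_N, (1 <= #|B i|)%N) ->
  (forall i j : 'I_N, (i <= j)%N -> (#|B i| <= #|B j|)%N) ->
  (#|[set x in box B | `[< rational_points X x >]]%SET|%:R
     <= d * \prod_(i < N | (theta <= i)%N) #|B i|%:R) /\
  (d * \prod_(i < N | (theta <= i)%N) #|B i|%:R
     = d * #|box B|%:R * \prod_(i < N | (i < theta)%N) (#|B i|%:R)^-1).
Proof.
move=> hcodim -> B_gt0 B_mono; split; first exact: rational_points_bound.
rewrite -mulrA; congr (_ * _).
(* The size of the box splits at [theta]; the factors below it cancel against their inverses, as the
   sides are nonempty. *)
rewrite card_bounded_ffun natr_prod prodfV [in RHS](bigID (fun i : 'I_N => (theta <= i)%N)) /=.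
have -> : \prod_(i < N | ~~ (theta <= i)%N) #|B i|%:R = \prod_(i < N | (i < theta)%N) #|B i|%:R :> rat.
  by apply: eq_bigl => i; rewrite -ltnNge.
rewrite mulfK //; apply/prodf_neq0 => i _.
by rewrite pnatr_eq0 -lt0n.
Qed.
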